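(* Let $(R,m)$ be a local noetherian (commutative) ring, and let $I,J\subsetneq R$ be proper ideals of $R$ such that $\sqrt I\nsubseteq\sqrt J$ and $\sqrt J\nsubseteq\sqrt I$. Suppose that $I\cap J$ is a cohomologically complete intersection of depth $h$, i.e. $\operatorname{depth}(I\cap J,R)=h$ and $\operatorname{H}^i_{I\cap J}(R)=0$ for all $i\neq h$. Then \[\operatorname{depth}(I+J,R)\leq h+1.\]
   Context: For an ideal $\mathfrak a$ of a noetherian ring $R$, $\operatorname{H}^i_{\mathfrak a}(R)$ denotes the $i$-th local cohomology module of $R$ with support in $\mathfrak a$, and $\sqrt{\mathfrak a}$ denotes the radical of $\mathfrak a$. For a proper ideal $\mathfrak a$, $\operatorname{depth}(\mathfrak a,R)$ denotes the grade of $\mathfrak a$ on $R$, i.e. the common length of the maximal $R$-regular sequences contained in $\mathfrak a$, equivalently the least $i$ with $\operatorname{H}^i_{\mathfrak a}(R)\neq 0$. An ideal $\mathfrak a$ of a local noetherian ring $R$ is called a cohomologically complete intersection if there is some $h$ such that $\operatorname{H}^i_{\mathfrak a}(R)=0$ for all $i\neq h$ (for a proper ideal this $h$ is then necessarily the height of $\mathfrak a$, and equals $\operatorname{depth}(\mathfrak a,R)$). *)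

(* Defs.v *)
(* MathComp, with the classical sets of MathComp-Analysis. *)
From mathcomp Require Import all_boot all_order all_algebra.
From mathcomp Require Import boolp classical_sets.

Set Implicit Arguments.
Unset Strict Implicit.
Unset Printing Implicit Defensive.

Import GRing.Theory.

Local Open Scope classical_set_scope.
Local Open Scope ring_scope.

Section Ideals.
Variable R : comNzRingType.
Implicit Types (I J K a m A : set R) (s : seq R).

(* MathComp's [idealr_closed] is about boolean predicates and builds in
   properness; here ideals are arbitrary sets and may be the unit ideal. *)
Definition is_ideal I : Prop :=
  [/\ I 0, forall x y, I x -> I y -> I (x + y) & forall r x, I x -> I (r * x)].

Definition is_proper_ideal I : Prop := is_ideal I /\ ~ I 1.

Definition ideal_gen A : set R :=
  [set x | forall K, is_ideal K -> A `<=` K -> K x].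

Definition ideal_sum I J : set R := [set x + y | x in I & y in J].

Definition ideal_prod I J : set R := ideal_gen [set x * y | x in I & y in J].

Definition ideal_pow a (n : nat) : set R := iter n (ideal_prod a) setT.

Definition radical a : set R := [set x | exists n : nat, a (x ^+ n)].

Definition noetherian : Prop :=
  forall I, is_ideal I -> exists s, I = ideal_gen [set` s].

Definition maximal_ideal m : Prop :=
  is_proper_ideal m /\ forall K, is_proper_ideal K -> m `<=` K -> K = m.

Definition local_ring m : Prop :=
  maximal_ideal m /\ forall m', maximal_ideal m' -> m' = m.

(* The first clause says that [s`_i] is a nonzerodivisor on
   R / (s`_0, ..., s`_(i-1)), the second that R / (s) is nonzero. *)
Definition regular_seq s : Prop :=
  (forall i, (i < size s)%N -> forall r,
     ideal_gen [set` take i s] (s`_i * r) -> ideal_gen [set` take i s] r)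
  /\ ~ ideal_gen [set` s] 1.

Definition maximal_regular_seq_in a s : Prop :=
  [/\ [set` s] `<=` a, regular_seq s &
      forall x, a x -> ~ regular_seq (rcons s x)].

(* depth(a, R) = n: maximal regular sequences in [a] exist, and n is their
   common length. *)
Definition has_depth a (n : nat) : Prop :=
  (exists s, maximal_regular_seq_in a s) /\
  (forall s, maximal_regular_seq_in a s -> size s = n).

End Ideals.

Arguments noetherian : clear implicits.

Section LocalCohomology.
Variable R : comNzRingType.
Implicit Types (a : set R) (M : lmodType R).

Definition injective_module (Q : lmodType R) : Prop :=
  forall (A B : lmodType R) (f : {linear A -> B}) (g : {linear A -> Q}),
    injective f -> exists g' : {linear B -> Q}, forall x, g' (f x) = g x.

(* 0 -> M -> Q^0 -> Q^1 -> ... exact, with every Q^i injective. *)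
Record injective_resolution M := InjectiveResolution {
  res_obj :> nat -> lmodType R;
  res_aug : {linear M -> res_obj 0};
  res_d : forall i, {linear res_obj i -> res_obj i.+1};
  res_injective : forall i, injective_module (res_obj i);
  res_aug_inj : injective res_aug;
  res_exact0 : [set x | res_d 0 x = 0] = range res_aug;
  res_exactS : forall i, [set x | res_d i.+1 x = 0] = range (res_d i)
}.

(* Gamma_a(M), the elements killed by some power of [a]. *)
Definition torsion a M : set M :=
  [set x | exists n, forall r, ideal_pow a n r -> r *: x = 0].
Arguments torsion : clear implicits.

(* H^i_a(M) is the i-th cohomology of Gamma_a(E), for E an injective
   resolution of M; up to isomorphism it does not depend on E. It is the
   quotient of [lc_cocycles] by [lc_coboundaries], hence zero when the former
   is contained in the latter. *)
Definition lc_cocycles M (E : injective_resolution M) a i : set (E i) :=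
  [set x | torsion a (E i) x /\ res_d E i x = 0].
Arguments lc_cocycles [M] E a i _ : assert.

Definition lc_coboundaries M (E : injective_resolution M) a i : set (E i) :=
  match i with
  | 0%N => [set 0]
  | j.+1 => res_d E j @` torsion a (E j)
  end.
Arguments lc_coboundaries [M] E a i _ : assert.

Definition local_cohomology_zero M (E : injective_resolution M) a i : Prop :=
  lc_cocycles E a i `<=` lc_coboundaries E a i.

End LocalCohomology.

(* Main.v *)
Require Import Defs.
From HB Require Import structures.
From mathcomp Require Import all_boot all_order all_algebra.
From mathcomp Require Import boolp classical_sets.
From mathcomp Require Import ring.

Set Implicit Arguments.
Unset Strict Implicit.
Unset Printing Implicit Defensive.

Import GRing.Theory.

Local Open Scope classical_set_scope.
Local Open Scope ring_scope.

(* Let a = I n J, c = I + J, and suppose depth(c, R) >= h + 2. Write G_b for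
   the b-torsion. The complex G_a(E) is exact above degree h and G_c(E) is exact
   up to degree h + 1, so that in the Mayer-Vietoris sequence
     0 -> G_c(E) -> G_I(E) + G_J(E) -> G_a(E) -> 0
   the truncation of G_a(E) in degrees <= h lifts, up to a complex without
   cohomology, to G_I(E) + G_J(E). Tensor with the Koszul complex of generators
   x_1, ..., x_r of a, as an iterated cone: R -> E and G_a(E) -> E become
   quasi-isomorphisms, and the class of 1 in the top cohomology R / a becomes
   the sum of an I-torsion class e and a J-torsion class e'. As R is local, one of
   them is a unit. Hence a contains a power of a given element of I, or of a
   given element of J, against the hypothesis on the radicals.

   The depth of c is read off from G_c(E) by Rees's argument: for a regular
   sequence s of length n in c, G_c(E) is exact below degree n, and not in
   degree n if s is maximal, because the elements of E killed by s form a complex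
   whose cohomology is R / (s) in degree n. *)

(** * Ideals and regular sequences *)

Section IdealTheory.
Variable R : comNzRingType.
Implicit Types (A I J K L a b c : set R) (s : seq R) (x y : R).

Lemma ideal0 I : is_ideal I -> I 0. Proof. by case. Qed.
Lemma idealD I x y : is_ideal I -> I x -> I y -> I (x + y).
Proof. by case=> _ + _; exact. Qed.
Lemma ideal_mull I r x : is_ideal I -> I x -> I (r * x).
Proof. by case=> _ _; exact. Qed.
Lemma ideal_mulr I r x : is_ideal I -> I x -> I (x * r).
Proof. by rewrite mulrC; exact: ideal_mull. Qed.
Lemma idealN I x : is_ideal I -> I x -> I (- x).
Proof. by move=> iI Ix; rewrite -mulN1r; exact: ideal_mull. Qed.
Lemma idealB I x y : is_ideal I -> I x -> I y -> I (x - y).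
Proof. by move=> iI Ix Iy; apply: idealD => //; exact: idealN. Qed.

Lemma ideal_genP A : is_ideal (ideal_gen A).
Proof.
split=> [K iK _|x y gx gy K iK AK|r x gx K iK AK]; first exact: ideal0.
- by apply: idealD => //; [exact: gx|exact: gy].
- by apply: ideal_mull => //; exact: gx.
Qed.

Lemma ideal_gen_sub A K : is_ideal K -> A `<=` K -> ideal_gen A `<=` K.
Proof. by move=> iK AK x; exact. Qed.

Lemma sub_ideal_gen A : A `<=` ideal_gen A.
Proof. by move=> x Ax K iK; exact. Qed.

Lemma ideal_gen_le A (A' : set R) : A `<=` A' -> ideal_gen A `<=` ideal_gen A'.
Proof.
move=> AA'; apply: ideal_gen_sub; first exact: ideal_genP.
by move=> x /AA'; exact: sub_ideal_gen.
Qed.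

Lemma ideal_capP I J : is_ideal I -> is_ideal J -> is_ideal (I `&` J).
Proof.
move=> iI iJ; split=> [|x y [? ?] [? ?]|r x [? ?]]; split;
  by [exact: ideal0|exact: idealD|exact: ideal_mull].
Qed.

Lemma ideal_sumP I J : is_ideal I -> is_ideal J -> is_ideal (ideal_sum I J).
Proof.
move=> iI iJ; split.
- by exists 0; [exact: ideal0|exists 0; [exact: ideal0|rewrite addr0]].
- move=> _ _ [x Ix [y Jy <-]] [x' Ix' [y' Jy' <-]].
  exists (x + x'); first exact: idealD.
  by exists (y + y'); [exact: idealD|rewrite addrACA].
- move=> r _ [x Ix [y Jy <-]]; exists (r * x); first exact: ideal_mull.
  by exists (r * y); [exact: ideal_mull|rewrite mulrDr].
Qed.

Lemma sub_ideal_suml I J : is_ideal J -> I `<=` ideal_sum I J.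
Proof. by move=> iJ x Ix; exists x => //; exists 0; [exact: ideal0|exact: addr0]. Qed.

Lemma sub_ideal_sumr I J : is_ideal I -> J `<=` ideal_sum I J.
Proof. by move=> iI x Jx; exists 0; [exact: ideal0|exists x => //; exact: add0r]. Qed.

Lemma ideal_sum_sub I J K : is_ideal K -> I `<=` K -> J `<=` K -> ideal_sum I J `<=` K.
Proof. by move=> iK IK JK _ [x Ix [y Jy <-]]; apply: idealD; [|exact: IK|exact: JK]. Qed.

Definition colon K x : set R := [set r | K (x * r)].

Lemma colonP K x : is_ideal K -> is_ideal (colon K x).
Proof.
move=> iK; rewrite /colon; split=> /= [|y z ? ?|r y ?].
- by rewrite mulr0; exact: ideal0.
- by rewrite mulrDr; exact: idealD.
- by rewrite mulrCA; exact: ideal_mull.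
Qed.

Lemma sub_colon K x : is_ideal K -> K `<=` colon K x.
Proof. by move=> iK y Ky; exact: ideal_mull. Qed.

Definition principal x : set R := [set y | exists r, y = r * x].

Lemma principalP x : is_ideal (principal x).
Proof.
split=> [|_ _ [r ->] [r' ->]|r _ [r' ->]].
- by exists 0; rewrite mul0r.
- by exists (r + r'); rewrite mulrDl.
- by exists (r * r'); rewrite mulrA.
Qed.

Lemma principal_mem x : principal x x. Proof. by exists 1; rewrite mul1r. Qed.

Lemma radicalP K : is_ideal K -> is_ideal (radical K).
Proof.
move=> iK; split.
- by exists 1%N; rewrite expr1; exact: ideal0.
- move=> x y [k Kx] [l Ky]; exists (k + l)%N; rewrite exprDn.
  apply: (big_ind (fun z => K z)) => [|? ?|i _]; [exact: ideal0|exact: idealD|].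
  rewrite -mulr_natl; apply: ideal_mull => //.
  have [le_li|/ltnW le_il] := leqP l i.
    by apply: ideal_mull => //; rewrite -(subnK le_li) exprD; exact: ideal_mull.
  apply: ideal_mulr => //; rewrite -addnBA // exprD.
  exact: ideal_mulr.
- by move=> r x [k Kx]; exists k; rewrite exprMn; exact: ideal_mull.
Qed.

Lemma ideal_gen_rcons s x z :
  ideal_gen [set` rcons s x] z <-> exists r, ideal_gen [set` s] (z - r * x).
Proof.
have gs := ideal_genP [set` s]; have gx := ideal_genP [set` rcons s x].
split=> [|[r szr]]; last first.
  rewrite -(subrK (r * x) z); apply: (idealD gx).
    by apply: (ideal_gen_le _ szr) => y /=; rewrite mem_rcons inE orbC => ->.
  by apply: (ideal_mull _ gx); apply: sub_ideal_gen => /=; rewrite mem_rcons mem_head.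
apply: (@ideal_gen_sub _ [set z | exists r, ideal_gen [set` s] (z - r * x)]).
  split=> [|y w [r sr] [r' sr']|t y [r sr]].
  - by exists 0; rewrite mul0r subr0; exact: ideal0 gs.
  - by exists (r + r'); rewrite mulrDl opprD addrACA; exact: (idealD gs).
  - by exists (t * r); rewrite -mulrA -mulrBr; exact: (ideal_mull _ gs).
move=> y /=; rewrite mem_rcons inE => /predU1P[->|sy].
  by exists 1; rewrite mul1r subrr; exact: ideal0 gs.
by exists 0; rewrite mul0r subr0; exact: sub_ideal_gen.
Qed.

Lemma ideal_gen_nil z : ideal_gen [set` [::]] z <-> z = 0 :> R.
Proof.
split=> [|->]; last exact: ideal0 (ideal_genP _).
apply: (@ideal_gen_sub _ [set z : R | z = 0]) => //.
by split=> [//|x y -> ->|r x ->] /=; rewrite ?addr0 ?mulr0.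
Qed.

(** * Consequences of the ascending chain condition *)

Hypothesis nR : noetherian R.

(** Otherwise choice gives a strictly ascending chain above K0; its union is an ideal, whose
    finitely many generators lie in one member, and the chain stops there. *)
Lemma noetherian_max (F : set (set R)) K0 :
    (forall K, F K -> is_ideal K) -> F K0 ->
  exists K, [/\ F K, K0 `<=` K & forall K', F K' -> K `<=` K' -> K' `<=` K].
Proof.
move=> Fi FK0; apply: contrapT => noK.
have step K : exists K', F K -> K0 `<=` K -> [/\ F K', K `<=` K' & ~ K' `<=` K].
  apply: contrapT => noK'; apply: noK; exists K.
  have [FK|nFK] := pselect (F K); last by case: noK'; exists K.
  have [K0K|nK0K] := pselect (K0 `<=` K); last by case: noK'; exists K.
  split=> // K' FK' KK'; apply: contrapT => nK'K.
  by apply: noK'; exists K'.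
have [f fP] := choice step.
pose k n := iter n f K0.
have kP n : F (k n) /\ K0 `<=` k n.
  elim: n => [|n [Fk K0k]]; first by split.
  by have [? kk' _] := fP _ Fk K0k; split=> // x /K0k /kk'.
have k_le m n : (m <= n)%N -> k m `<=` k n.
  move/subnK <-; elim: (n - m)%N => [//|p IH] x /IH.
  by have [Fk K0k] := kP (p + m)%N; have [_ kk' _] := fP _ Fk K0k; exact: kk'.
pose U := [set x | exists n, k n x].
have iU : is_ideal U.
  split=> [|x y [m mx] [n ny]|r x [n nx]].
  - by exists 0%N; have [Fk _] := kP 0%N; exact: ideal0 (Fi _ Fk).
  - exists (maxn m n); have [Fk _] := kP (maxn m n); apply: idealD (Fi _ Fk) _ _.
      exact: k_le (leq_maxl _ _) _ mx.
    exact: k_le (leq_maxr _ _) _ ny.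
  - by exists n; have [Fk _] := kP n; exact: ideal_mull (Fi _ Fk) nx.
have [s Us] := nR iU.
have [N sN] : exists N, [set` s] `<=` k N.
  have : [set` s] `<=` U by rewrite Us; exact: sub_ideal_gen.
  elim: s {Us} => [|x s IH] sU; first by exists 0%N.
  have [|m sm] := IH; first by move=> y ys; apply: sU => /=; rewrite inE ys orbT.
  have [n xn] : U x by apply: sU => /=; exact: mem_head.
  exists (maxn m n) => y /=; rewrite inE => /predU1P[->|ys].
    exact: k_le (leq_maxr _ _) _ xn.
  exact: k_le (leq_maxl _ _) _ (sm _ ys).
have [FN K0N] := kP N; have [_ _] := fP _ FN K0N; apply=> x kx.
suff : U x by rewrite Us; apply: ideal_gen_sub => //; exact: Fi.
by exists N.+1.
Qed.

(** The colon ideals of K by the powers of x ascend, so they become stationary. *)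
Lemma colon_stable K x : is_ideal K ->
  exists n, forall m r, K (x ^+ m * r) -> K (x ^+ n * r).
Proof.
move=> iK.
have [|//|_ [[n ->] _ nmax]] := @noetherian_max
    [set L | exists n, L = colon K (x ^+ n)] (colon K (x ^+ 0)).
- by move=> _ [n ->]; exact: colonP.
- by exists 0%N.
exists n => m r Kmr; have [le_mn|/ltnW le_nm] := leqP m n.
  by rewrite -(subnK le_mn) exprD -mulrA; exact: ideal_mull.
apply: (nmax (colon K (x ^+ m))) => //; first by exists m.
by move=> y Ky; rewrite /colon /= -(subnK le_nm) exprD -mulrA; exact: ideal_mull.
Qed.

(* [C] is maximal among the ideals that meet [K] in [J]. *)
Lemma weak_artin_rees J K : is_ideal J -> is_ideal K -> J `<=` K ->
  exists C, [/\ is_ideal C, J `<=` C, C `&` K `<=` J &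
    forall x, (forall y, K y -> exists n, J (x ^+ n * y)) -> exists n, C (x ^+ n)].
Proof.
move=> iJ iK JK.
have [|//|C [[iC CK] JC Cmax]] := @noetherian_max
    [set C | is_ideal C /\ C `&` K `<=` J] J.
  by move=> C [].
exists C; split=> // x xP; have [k kP] := colon_stable x iC.
have iC' := ideal_sumP iC (principalP (x ^+ k)).
(* By maximality of [C] it is enough that C + (x^k) still meets K within J. *)
exists k; apply: (Cmax (ideal_sum C (principal (x ^+ k)))); last first.
- exact: sub_ideal_sumr (principal_mem _).
- exact: sub_ideal_suml (principalP _).
split=> // _ [[c Cc [_ [r ->] <-]]] Ky; have [n Jn] := xP _ Ky.
suff Cr : C (r * x ^+ k) by apply: CK; split => //; exact: idealD.
rewrite mulrC; apply: (kP (n + k)%N); have /JC Cn := Jn.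
rewrite exprD -mulrA (mulrC _ r).
have -> : x ^+ n * (r * x ^+ k) = x ^+ n * (c + r * x ^+ k) - x ^+ n * c by ring.
by apply: idealB => //; exact: ideal_mull.
Qed.

(** Does the work of a^(n+m) = a^n a^m. The induction peels off a factor y of a by passing from K
    and L to their colons by y. *)
Lemma ideal_pow_add a (m n : nat) K L : is_ideal K -> is_ideal L ->
    ideal_pow a n `<=` K ->
    (forall x y, ideal_pow a m x -> K y -> L (x * y)) ->
  ideal_pow a (n + m) `<=` L.
Proof.
elim: n K L => [|n IH] K L iK iL nK KL.
  by move=> x ax; rewrite -(mulr1 x); apply: KL => //; exact: nK.
rewrite addSn; apply: ideal_gen_sub => // _ [y ay [z az <-]].
apply: (IH (colon K y) (colon L y)) az; [exact: colonP|exact: colonP| |].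
- by move=> w aw; apply: nK; apply: sub_ideal_gen; exists y => //; exists w.
- by move=> x w ax Kw; rewrite /colon /= mulrCA; exact: KL.
Qed.

Lemma ideal_pow_mem a x n : a x -> ideal_pow a n (x ^+ n).
Proof.
move=> ax; elim: n => [//|n IH].
by apply: sub_ideal_gen; exists x => //; exists (x ^+ n); rewrite -?exprS.
Qed.

(** Noetherian induction. If M is maximal among the ideals without a power of a and y in a lies
    outside M, then both M + (y) and M : y contain powers of a, and the product of these lies in
    M. *)
Lemma ideal_pow_sub_radical a L : is_ideal L ->
  a `<=` radical L -> exists n, ideal_pow a n `<=` L.
Proof.
move=> iL aL; apply: contrapT => noL.
have [|//|M [[iM noM] LM Mmax]] := @noetherian_max
    [set M | is_ideal M /\ ~ exists n, ideal_pow a n `<=` M] L.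
- by move=> M [].
have big K : is_ideal K -> M `<=` K -> ~ K `<=` M -> exists n, ideal_pow a n `<=` K.
  by move=> iK MK KM; apply: contrapT => nK; apply: KM; apply: Mmax.
have [y ay My] : exists2 y, a y & ~ M y.
  apply: contrapT => all_aM; apply: noM; exists 1%N.
  apply: ideal_gen_sub => // _ [y ay [z _ <-]]; apply: ideal_mulr => //.
  by apply: contrapT => My; apply: all_aM; exists y.
have [k] : exists k, M (y ^+ k) by have [k /LM] := aL _ ay; exists k.
(* Descend to a power y^k outside M with y^(k+1) in M: it lies in M : y, which is therefore larger
   than M. *)
elim: k => [M1|k IH Mk1].
  by apply: My; rewrite -(mulr1 y); apply: ideal_mull.
have [/IH //|Mk] := pselect (M (y ^+ k)).
have iy := principalP y; have iMy := ideal_sumP iM iy.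
have [||n nMy] := big _ iMy; first exact: sub_ideal_suml.
  by move/(_ y); apply: contra_not My; apply; exact: sub_ideal_sumr (principal_mem y).
have [||m mMy] := big _ (colonP y iM); first exact: sub_colon.
  by move/(_ (y ^+ k)); rewrite /colon /= -exprS => /(_ Mk1).
apply: noM; exists (n + m)%N; apply: ideal_pow_add nMy _ => //.
move=> x _ /mMy Myx [u Mu [_ [r ->] <-]]; rewrite mulrDr; apply: idealD => //.
  exact: ideal_mull.
have -> : x * (r * y) = r * (y * x) by ring.
exact: ideal_mull.
Qed.

(* The maximal annihilators of elements of R / b are primes, finitely many of
   them determine all the others, and [c] avoids these. *)
Lemma exists_nonzerodivisor b c : is_ideal b -> is_ideal c ->
    (forall r, (forall y, c y -> b (y * r)) -> b r) ->
  exists2 x, c x & forall r, b (x * r) -> b r.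
Proof.
move=> ib ic cb.
pose ann r := [set x | b (x * r)].
have annP r : is_ideal (ann r).
  split=> /= [|x y ? ?|t x ?]; first by rewrite /ann /= mul0r; exact: ideal0.
    by rewrite /ann /= mulrDl; exact: idealD.
  by rewrite /ann /= -mulrA; exact: ideal_mull.
pose mx r := ~ b r /\ forall r', ~ b r' -> ann r `<=` ann r' -> ann r' `<=` ann r.
have ex_mx r : ~ b r -> exists2 r', mx r' & ann r `<=` ann r'.
  move=> br; have [|//|_ [[r' [br' ->]] rr' r'max]] := @noetherian_max
      [set A | exists r, ~ b r /\ A = ann r] (ann r).
  - by move=> _ [r' [_ ->]].
  - by exists r.
  by exists r' => //; split=> // r'' br'' ; apply: r'max; exists r''.
have mx_prime r x y : mx r -> ann r (x * y) -> ann r x \/ ann r y.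
  move=> [br rmax] xyr; have [|nyr] := pselect (ann r y); [by right|left].
  apply: (rmax (y * r)) => //.
    by move=> z zr; rewrite /ann /= mulrCA; exact: ideal_mull.
  by rewrite /ann /= mulrA.
(* The ideal generated by all elements with maximal annihilator is generated by finitely many of
   them; what multiplies these into b does so for all. *)
have [s sP] : exists s : seq R, (forall r, r \in s -> mx r) /\
    forall r, mx r -> forall x, (forall t, t \in s -> ann t x) -> ann r x.
  have [|//|M [[s [smx ->]] _ Mmax]] := @noetherian_max
      [set M | exists s : seq R, (forall r, r \in s -> mx r) /\ M = ideal_gen [set` s]]
      (ideal_gen [set` [::]]).
  - by move=> _ [s [_ ->]]; exact: ideal_genP.
  - by exists [::].
  exists s; split=> // r mxr x xs; rewrite /ann /=.
  apply: (@ideal_gen_sub [set` s] (colon b x) _ _ r); first exact: colonP.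
    by move=> t ts; exact: xs.
  apply: (Mmax (ideal_gen [set` rcons s r])).
  - exists (rcons s r); split=> // t; rewrite mem_rcons inE => /predU1P[-> //|].
    exact: smx.
  - by apply: ideal_gen_le => y /=; rewrite mem_rcons inE orbC => ->.
  - by apply: sub_ideal_gen; rewrite /= mem_rcons mem_head.
case: sP => smx sann.
(* Prime avoidance: if x lies in [ann p], add to it an element y of c that lies in [ann r] for every
   r in q but not in [ann p]. *)
have avoid (q : seq R) : (forall r, r \in q -> mx r) ->
    exists2 x, c x & forall r, r \in q -> ~ ann r x.
  elim: q => [|p q IH] qmx; first by exists 0 => //; exact: ideal0.
  have [|x cx xq] := IH; first by move=> r rq; apply: qmx; rewrite inE rq orbT.
  have mxp : mx p by apply: qmx; exact: mem_head.
  have [px|npx] := pselect (ann p x); last first.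
    by exists x => // r; rewrite inE => /predU1P[-> //|]; exact: xq.
  have [y [cy yq npy]] : exists y, [/\ c y, forall r, r \in q -> ann r y & ~ ann p y].
    have {IH} : forall r, r \in q -> mx r /\ ~ ann r x.
      by move=> r rq; split; [apply: qmx; rewrite inE rq orbT|exact: xq].
    elim: q {qmx xq} => [|r q IH] qP.
      apply: contrapT => noy; case: mxp => bp _; apply: bp; apply: cb => y cy.
      by apply: contrapT => npy; apply: noy; exists y.
    have [|y [cy yq npy]] := IH; first by move=> t tq; apply: qP; rewrite inE tq orbT.
    have [[br rmax] nrx] := qP r (mem_head _ _).
    have [z rz npz] : exists2 z, ann r z & ~ ann p z.
      apply: contrapT => noz; apply: nrx; apply: (rmax p) => //; first by case: mxp.
      by move=> z rz; apply: contrapT => npz; apply: noz; exists z.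
    exists (y * z); split; first exact: ideal_mulr.
      move=> t; rewrite inE => /predU1P[->|tq]; first exact: ideal_mull.
      by apply: ideal_mulr => //; exact: yq.
    by case/(mx_prime _ _ _ mxp).
  exists (x + y); first exact: idealD.
  move=> r; rewrite inE => /predU1P[->|rq].
    by move=> pxy; apply: npy; rewrite -(addKr x y) addrC; exact: idealB.
  by move=> rxy; apply: (xq _ rq); rewrite -(addrK y x); apply: idealB => //; exact: yq.
have [x cx xs] := avoid _ smx.
exists x => // r bxr; apply: contrapT => br.
have [p mxp rp] := ex_mx _ br.
(* The prime [ann p] contains the intersection of the finitely many [ann t], t in s, hence one of
   them. *)
have [q [qs qp]] : exists q, q \in s /\ ann q `<=` ann p.
  apply: contrapT => noq.
  suff [y ys npy] : exists2 y, (forall t, t \in s -> ann t y) & ~ ann p y.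
    by apply: npy; exact: sann.
  elim: (s) noq => [|t q IH] noq.
    by exists 1 => // p1; case: mxp; rewrite /ann /= mul1r in p1.
  have [|y yq npy] := IH.
    by case=> t' [t'q t'p]; apply: noq; exists t'; rewrite inE t'q orbT.
  have [z tz npz] : exists2 z, ann t z & ~ ann p z.
    apply: contrapT => noz; apply: noq; exists t; rewrite mem_head; split=> // z tz.
    by apply: contrapT => npz; apply: noz; exists z.
  exists (y * z); last by case/(mx_prime _ _ _ mxp).
  move=> t'; rewrite inE => /predU1P[->|t'q]; first exact: ideal_mull.
  by apply: ideal_mulr => //; exact: yq.
by apply: (xs _ qs); apply: (smx _ qs).2 qp _ (rp _ bxr); case: mxp.
Qed.

Lemma proper_sub_maximal m K : local_ring m -> is_proper_ideal K -> K `<=` m.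
Proof.
move=> [_ m_uniq] pK.
have [|//|M [pM KM Mmax]] := @noetherian_max (@is_proper_ideal R) K.
  by move=> L [].
suff -> : m = M by [].
apply/esym/m_uniq; split=> // L pL ML.
by apply/seteqP; split=> // x; exact: Mmax.
Qed.

Lemma local_unit m x : local_ring m -> ~ m x -> exists y, y * x = 1.
Proof.
move=> lm mx; apply: contrapT => nox; apply: mx.
apply: (proper_sub_maximal lm _ (principal_mem x)).
by split; [exact: principalP|case=> y yx; apply: nox; exists y].
Qed.

(** * Regular sequences *)

Definition nonzerodivisor_mod b x : Prop := forall r, b (x * r) -> b r.

Lemma regular_seq_nil : regular_seq ([::] : seq R).
Proof. by split=> // /ideal_gen_nil /eqP; rewrite oner_eq0. Qed.

Lemma regular_seq_rcons s x : regular_seq (rcons s x) <->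
  [/\ regular_seq s, nonzerodivisor_mod (ideal_gen [set` s]) x &
      ~ ideal_gen [set` rcons s x] 1].
Proof.
have take_lt i : (i < size s)%N -> take i (rcons s x) = take i s.
  by move=> lt_is; rewrite -cats1 take_cat lt_is.
have s1 : ideal_gen [set` s] 1 -> ideal_gen [set` rcons s x] 1.
  by apply: ideal_gen_le => y /=; rewrite mem_rcons inE orbC => ->.
split=> [[reg nsx1]|[[reg _] regx nsx1]].
- split=> //; last first.
    move=> r; have := reg (size s); rewrite size_rcons ltnS leqnn => /(_ isT r).
    by rewrite nth_rcons ltnn eqxx -cats1 take_cat ltnn subnn take0 cats0.
  split; last by move/s1.
  move=> i lt_is r; have := reg i; rewrite size_rcons => /(_ (ltnW lt_is) r).
  by rewrite nth_rcons lt_is take_lt.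
- split=> // i; rewrite size_rcons ltnS leq_eqVlt => /predU1P[->|lt_is] r.
    by rewrite nth_rcons ltnn eqxx -cats1 take_cat ltnn subnn take0 cats0; exact: regx.
  by rewrite nth_rcons lt_is take_lt //; exact: reg.
Qed.

(** Take s so that (s) is maximal among the ideals generated by regular sequences in c. A
    prolongation x would lie in (s), and so could not be a nonzerodivisor on R / (s), which is
    nonzero. *)
Lemma exists_maximal_regular_seq_in c : exists s, maximal_regular_seq_in c s.
Proof.
have [|//|M [[s [sc sreg ->]] _ Mmax]] := @noetherian_max
    [set M | exists s, [/\ [set` s] `<=` c, regular_seq s & M = ideal_gen [set` s]]]
    (ideal_gen [set` [::]]).
- by move=> _ [s [_ _ ->]]; exact: ideal_genP.
- by exists [::]; split=> //; exact: regular_seq_nil.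
exists s; split=> // x cx xreg; have /regular_seq_rcons[[_ ns1] regx _] := xreg.
apply: ns1; apply: regx; rewrite mulr1.
apply: (Mmax (ideal_gen [set` rcons s x])).
- exists (rcons s x); split=> // y /=; rewrite mem_rcons inE => /predU1P[-> //|].
  exact: sc.
- by apply: ideal_gen_le => y /=; rewrite mem_rcons inE orbC => ->.
- by apply: sub_ideal_gen; rewrite /= mem_rcons mem_head.
Qed.

(** If c killed no nonzero class of R / (s), it would contain a nonzerodivisor modulo (s), which
    would prolong s. *)
Lemma maximal_regular_seq_ann c s : is_proper_ideal c ->
    maximal_regular_seq_in c s ->
  exists2 r, ~ ideal_gen [set` s] r &
    forall y, c y -> ideal_gen [set` s] (y * r).
Proof.
move=> [ic c1] [sc sreg smax]; apply: contrapT => nor.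
have [|x cx regx] := exists_nonzerodivisor (ideal_genP [set` s]) ic.
  by move=> r rP; apply: contrapT => nr; apply: nor; exists r.
apply: (smax x cx); apply/regular_seq_rcons; split=> // sx1; apply: c1.
apply: (ideal_gen_sub _ _ sx1) => // y /=; rewrite mem_rcons inE => /predU1P[-> //|].
exact: sc.
Qed.

End IdealTheory.

(** * Torsion and Baer's criterion *)

Section Submodules.
Variable R : comNzRingType.
Implicit Types (M : lmodType R) (a b I J K L : set R).

Definition is_submod M (P : set M) : Prop :=
  [/\ P 0, forall x y, P x -> P y -> P (x + y) & forall r x, P x -> P (r *: x)].

Lemma submod0 M (P : set M) : is_submod P -> P 0. Proof. by case. Qed.
Lemma submodD M (P : set M) x y : is_submod P -> P x -> P y -> P (x + y).
Proof. by case=> _ + _; exact. Qed.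
Lemma submodZ M (P : set M) r x : is_submod P -> P x -> P (r *: x).
Proof. by case=> _ _; exact. Qed.
Lemma submodN M (P : set M) x : is_submod P -> P x -> P (- x).
Proof. by move=> sP Px; rewrite -scaleN1r; exact: submodZ. Qed.
Lemma submodB M (P : set M) x y : is_submod P -> P x -> P y -> P (x - y).
Proof. by move=> sP Px Py; apply: submodD => //; exact: submodN. Qed.

Lemma submodI M (P P' : set M) : is_submod P -> is_submod P' -> is_submod (P `&` P').
Proof.
move=> sP sP'; split=> [|x y [? ?] [? ?]|r x [? ?]]; split;
  by [exact: submod0|exact: submodD|exact: submodZ].
Qed.

Lemma submodT M : is_submod [set: M]. Proof. by []. Qed.

Definition annihilator M (x : M) : set R := [set r | r *: x = 0].

Lemma annihilatorP M (x : M) : is_ideal (annihilator x).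
Proof.
rewrite /annihilator; split=> /= [|r s rx sx|r s sx].
- by rewrite scale0r.
- by rewrite scalerDl rx sx addr0.
- by rewrite -scalerA sx scaler0.
Qed.

Definition killed b M : set M := [set x | b `<=` annihilator x].
Arguments killed b {M}.

Lemma killedP b M : is_submod (@killed b M).
Proof.
split=> [r _|x y bx by_ r br|r x bx s bs]; rewrite /annihilator /=.
- exact: scaler0.
- by rewrite scalerDr bx // by_ // addr0.
- by rewrite scalerA mulrC -scalerA bx // scaler0.
Qed.

(** The exponent may vary over a, so that generators of a suffice to test this; over a noetherian
    ring it is the usual torsion, by [torsionE]. *)
Definition rad_torsion a M : set M := [set x | a `<=` radical (annihilator x)].
Arguments rad_torsion a {M}.

Lemma rad_torsionP a M : is_submod (@rad_torsion a M).
Proof.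
split=> [r _|x y ax ay r ar|r x ax s as_].
- by exists 0%N; exact: scaler0.
- have [k kx] := ax _ ar; have [l ly] := ay _ ar.
  exists (k + l)%N; rewrite /annihilator /= scalerDr {1}addnC !exprD -!scalerA.
  by rewrite kx ly !scaler0 addr0.
- have [k kx] := ax _ as_; exists k.
  by rewrite /annihilator /= scalerA mulrC -scalerA kx scaler0.
Qed.

Lemma rad_torsion_lin a M (N : lmodType R) (f : {linear M -> N}) x :
  rad_torsion a x -> rad_torsion a (f x).
Proof.
move=> ax r /ax[k kx]; exists k.
by rewrite /annihilator /= -linearZ kx linear0.
Qed.

Lemma killed_lin b M (N : lmodType R) (f : {linear M -> N}) x : killed b x -> killed b (f x).
Proof. by move=> bx r br; rewrite /annihilator /= -linearZ bx // linear0. Qed.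

Lemma rad_torsion_ideal_gen (A : set R) M :
  @rad_torsion (ideal_gen A) M = rad_torsion A.
Proof.
apply/seteqP; split=> x Ax.
  by move=> y Ay; apply: Ax; exact: sub_ideal_gen.
apply: ideal_gen_sub => //; exact/radicalP/annihilatorP.
Qed.

Lemma rad_torsion_ideal_sum I J M : is_ideal I -> is_ideal J ->
  @rad_torsion (ideal_sum I J) M = rad_torsion I `&` @rad_torsion J M.
Proof.
move=> iI iJ; apply/seteqP; split=> [x IJx|x [Ix Jx]]; first split.
- by move=> y Iy; apply: IJx; exact: sub_ideal_suml.
- by move=> y Jy; apply: IJx; exact: sub_ideal_sumr.
- by apply: ideal_sum_sub => //; exact/radicalP/annihilatorP.
Qed.

Lemma torsionE a M : noetherian R -> @torsion R a M = @rad_torsion a M.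
Proof.
move=> nR; apply/seteqP; split=> x.
  by move=> [n nx] r ar; exists n; apply: nx; exact: ideal_pow_mem.
by move=> /(ideal_pow_sub_radical nR (annihilatorP x))[n nx]; exists n.
Qed.

Definition is_submod_graph M (G : R -> M -> Prop) : Prop :=
  [/\ G 0 0, forall x y p q, G x p -> G y q -> G (x + y) (p + q)
     & forall r x p, G x p -> G (r * x) (r *: p)].

(* Baer's criterion for [P] as a module over R / b. A homomorphism from an
   ideal of R to [P] is given by its graph [G], so that no quotient modules are
   needed: it factors through R / b when [G] contains [b * 0]. *)
Definition baer b M (P : set M) : Prop :=
  forall G : R -> M -> Prop, is_submod_graph G ->
    (forall x p, G x p -> P p) -> (forall p, G 0 p -> p = 0) ->
    (forall r, b r -> G r 0) ->
  exists2 q, P q & forall x p, G x p -> p = x *: q.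

(** * Injectivity in terms of graphs *)

Section GraphModule.
Variables (M : lmodType R) (G : R -> M -> Prop) (sG : is_submod_graph G).

Definition graph_pred : {pred R^o * M} := fun p => `[< G p.1 p.2 >].

Fact graph_pred_closed : submod_closed graph_pred.
Proof.
case: sG => G0 GD GZ; split; first exact/asboolP.
move=> r p q /asboolP Gp /asboolP Gq; apply/asboolP.
by apply: GD => //; exact: GZ.
Qed.

HB.instance Definition _ :=
  GRing.isSubmodClosed.Build R _ graph_pred graph_pred_closed.

(** The graph is made a module type because [injective_module] quantifies over these. *)
Record graph_mod : Type :=
  GraphMod { graph_val : R^o * M; _ : graph_val \in graph_pred }.

HB.instance Definition _ := [isSub for graph_val].
HB.instance Definition _ := [Choice of graph_mod by <:].
HB.instance Definition _ := [SubChoice_isSubLmodule of graph_mod by <:].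

Definition graph_fst (u : graph_mod) : R^o := (val u).1.
Definition graph_snd (u : graph_mod) : M := (val u).2.

Fact graph_fst_linear : linear graph_fst. Proof. by []. Qed.
Fact graph_snd_linear : linear graph_snd. Proof. by []. Qed.
HB.instance Definition _ :=
  GRing.isLinear.Build R graph_mod R^o _ graph_fst graph_fst_linear.
HB.instance Definition _ :=
  GRing.isLinear.Build R graph_mod M _ graph_snd graph_snd_linear.

(** The first projection of the graph is injective, so the second extends along it to R; q is the
    image of 1. *)
Lemma injective_graph : injective_module M ->
  (forall p, G 0 p -> p = 0) -> exists q, forall x p, G x p -> p = x *: q.
Proof.
move=> injM G0.
have inj1 : injective graph_fst.
  move=> u v uv; apply/eqP; rewrite -subr_eq0; apply/eqP/val_inj.
  have : val (u - v) \in graph_pred by case: (u - v).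
  have : (val (u - v)).1 = 0.
    by rewrite -[LHS]/(graph_fst u - graph_fst v) uv subrr.
  have -> : val (0 : graph_mod) = (0, 0) by [].
  by case: (val (u - v)) => x p /= -> /asboolP /G0 /= ->.
have [g gP] := injM _ _ graph_fst graph_snd inj1.
exists (g 1) => x p Gxp; have Gin : (x, p) \in graph_pred by exact/asboolP.
have <- : g x = p := gP (GraphMod Gin).
by rewrite -linearZ /= -[X in g X = _]mulr1.
Qed.

End GraphModule.

Lemma injective_baer b M : injective_module M -> baer b [set: M].
Proof.
move=> injM G sG _ G0 _; have [q qP] := injective_graph sG injM G0.
by exists q.
Qed.

(** Extend inside P: an element r of b' has (r, 0) in the graph, so r kills q. *)
Lemma baer_killed b b' M (P : set M) : b `<=` b' -> baer b P -> baer b' (P `&` killed b').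
Proof.
move=> bb' BP G sG GP G0 Gb; have [||q Pq qP] := BP G sG _ G0.
- by move=> x p /GP[].
- by move=> r /bb'; exact: Gb.
by exists q => //; split=> // r /Gb /qP.
Qed.

(** An extension q in P need not be torsion. Weak Artin-Rees gives an ideal C that meets the domain
    K within the annihilator of q and contains a power of each element of a. The map y + c -> y q on
    K + C is then well defined, and extends to some q' killed by C. *)
Lemma baer_rad_torsion a b M (P : set M) : noetherian R ->
  baer b P -> baer b (P `&` rad_torsion a).
Proof.
move=> nR BP G sG GP G0 Gb; have [G00 GD GZ] := sG.
have [|q Pq qP] := BP G sG _ G0 Gb; first by move=> x p /GP[].
pose K := [set x | exists p, G x p].
have iK : is_ideal K.
  split=> [|x y [p xp] [p' yp']|r x [p xp]]; first by exists 0.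
    by exists (p + p'); exact: GD.
  by exists (r *: p); exact: GZ.
have iA := annihilatorP q.
have iKA : is_ideal (K `&` annihilator q) by exact: ideal_capP.
have [C [iC KAC CK Crad]] := weak_artin_rees nR iKA iK (@subIsetl _ _ _).
pose G' x p := exists y c, [/\ K y, C c, x = y + c & p = y *: q].
have [|||r br|q' Pq' q'P] := BP G'.
- split.
  + by exists 0, 0; rewrite scale0r addr0; split=> //; exact: ideal0.
  + move=> _ _ _ _ [y [c [Ky Cc -> ->]]] [y' [c' [Ky' Cc' -> ->]]].
    exists (y + y'), (c + c'); rewrite scalerDl addrACA.
    by split=> //; exact: idealD.
  + move=> r _ _ [y [c [Ky Cc -> ->]]]; exists (r * y), (r * c).
    by rewrite mulrDr scalerA; split=> //; exact: ideal_mull.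
- by move=> _ _ [y [c [[p yp] _ _ ->]]]; rewrite -(qP _ _ yp); case: (GP _ _ yp).
- move=> p [y [c [Ky Cc /esym/eqP]]]; rewrite addr_eq0 => /eqP yc ->.
  suff [] : (K `&` annihilator q) y by [].
  by apply: CK; split=> //; rewrite yc; exact: idealN.
- exists r, 0; rewrite addr0 -(qP _ _ (Gb _ br)).
  by split=> //; [exists 0; exact: Gb|exact: ideal0].
exists q'.
  split=> // x ax; have [|n Cn] := Crad x.
    move=> y [p yp]; have [_ /(_ _ ax)[n nyp]] := GP _ _ yp.
    exists n; split; first by apply: ideal_mull => //; exists p.
    by rewrite /annihilator /= -scalerA -(qP _ _ yp).
  exists n; rewrite /annihilator /= -(q'P (x ^+ n) 0) //.
  by exists 0, (x ^+ n); rewrite add0r scale0r; split=> //; exact: ideal0.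
move=> x p xp; rewrite (qP _ _ xp); apply: q'P.
by exists x, 0; rewrite addr0; split=> //; [exists p|exact: ideal0].
Qed.

(** The hypothesis on x makes the map r x^(n+1) + l -> r x^n q well defined on (x^(n+1)) + b; q' is
    an extension. *)
Lemma baer_div b M (P : set M) x n q : is_ideal b -> baer b P ->
    is_submod P -> P `<=` killed b -> (forall r, b (x ^+ n.+1 * r) -> b (x ^+ n * r)) ->
  P q -> exists2 q', P q' & x ^+ n.+1 *: q' = x ^+ n *: q.
Proof.
move=> ib BP sP Pb bx Pq.
pose G y p := exists r l, [/\ b l, y = r * x ^+ n.+1 + l & p = r *: (x ^+ n *: q)].
have [|||r br|q' Pq' q'P] := BP G.
- split.
  + by exists 0, 0; rewrite mul0r addr0 scale0r; split=> //; exact: ideal0.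
  + move=> _ _ _ _ [r [l [bl -> ->]]] [r' [l' [bl' -> ->]]].
    exists (r + r'), (l + l'); rewrite mulrDl scalerDl addrACA.
    by split=> //; exact: idealD.
  + move=> t _ _ [r [l [bl -> ->]]]; exists (t * r), (t * l).
    by rewrite mulrDr mulrA scalerA; split=> //; exact: ideal_mull.
- by move=> _ _ [r [l [_ _ ->]]]; do 2!apply: submodZ => //.
- move=> p [r [l [bl /esym/eqP]]]; rewrite addr_eq0 => /eqP rl ->.
  rewrite scalerA mulrC; apply: (Pb _ Pq).
  by apply: bx; rewrite mulrC rl; exact: idealN.
- by exists 0, r; rewrite mul0r add0r scale0r.
exists q' => //; apply/esym/q'P; exists 1, 0; rewrite mul1r addr0 scale1r.
by split=> //; exact: ideal0.
Qed.

(** The colons of b by the powers of x^k become stationary, which is the condition of [baer_div];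
    the price is an error killed by a power of x. *)
Lemma baer_quasi_div b M (P : set M) x k q : noetherian R -> is_ideal b ->
    baer b P -> is_submod P -> P `<=` killed b -> P q ->
  exists n, exists2 q', P q' & x ^+ n *: (x ^+ k *: q' - q) = 0.
Proof.
move=> nR ib BP sP Pb Pq; have [n nP] := colon_stable nR (x ^+ k) ib.
have [|q' Pq' e] := baer_div (x := x ^+ k) (n := n) ib BP sP Pb _ Pq.
  by move=> r; exact: nP.
exists (k * n)%N; exists q' => //.
by rewrite exprM scalerBr scalerA -exprSr e subrr.
Qed.

(** Replaces primary decomposition. Choose L1 maximal, starting from the pair L, R. For x in I and n
    large, the pair L1 + (x^n), L2 n (L1 : x^n) still qualifies, because x y lies in I n J for y in
    J; so x^n is in L1. *)
Lemma radical_cap_split I J L : noetherian R -> is_ideal I -> is_ideal J -> is_ideal L ->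
    I `&` J `<=` radical L ->
  exists L1 L2, [/\ is_ideal L1, is_ideal L2, L `<=` L1 /\ L `<=` L2,
    L1 `&` L2 `<=` L & I `<=` radical L1 /\ J `<=` radical L2].
Proof.
move=> nR iI iJ iL IJL.
have [||L1 [[iL1 [L2 [iL2 LL2 L12 JL2]]] LL1 L1max]] := @noetherian_max _ nR
    [set L1 | is_ideal L1 /\ exists L2,
      [/\ is_ideal L2, L `<=` L2, L1 `&` L2 `<=` L & J `<=` radical L2]] L.
- by move=> K [].
- split=> //; exists setT; split=> //.
  by move=> y _; exists 0%N.
exists L1, L2; split=> //; split=> // x Ix.
have [n nP] := colon_stable nR x iL1.
have ix := principalP (x ^+ n); have iL1' := ideal_sumP iL1 ix.
exists n; apply: (L1max (ideal_sum L1 (principal (x ^+ n)))); last first.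
- exact: sub_ideal_sumr (principal_mem _).
- exact: sub_ideal_suml ix.
split=> //; exists (L2 `&` colon L1 (x ^+ n)).
have iC := colonP (x ^+ n) iL1.
split; first exact: ideal_capP.
- by move=> y Ly; split; [exact: LL2|apply: sub_colon => //; exact: LL1].
- move=> _ [[l L1l [_ [r ->] <-]] [L2y]]; rewrite /colon /= => L1y.
  suff L1r : L1 (r * x ^+ n) by apply: L12; split => //; exact: idealD.
  rewrite mulrC; apply: (nP (n + n)%N).
  have -> : x ^+ (n + n) * r = x ^+ n * (l + r * x ^+ n) - x ^+ n * l.
    by rewrite exprD; ring.
  by apply: idealB => //; exact: ideal_mull.
- move=> y Jy; have [k L2k] := JL2 _ Jy.
  have IJxy : (I `&` J) (x * y) by split; [exact: ideal_mulr|exact: ideal_mull].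
  have [l] := IJL _ IJxy.
  rewrite exprMn => /LL1/nP L1l.
  exists (k + l)%N; rewrite exprD; split; first exact: ideal_mulr.
  by rewrite /colon /= mulrCA; exact: ideal_mull.
Qed.

(** Surjectivity in the Mayer-Vietoris sequence. Split the annihilator of q into L1 and L2; the map
    l1 + l2 -> l2 q is well defined on L1 + L2 and extends to u, so that L1 kills u and L2 kills q -
    u. *)
Lemma baer_rad_torsion_cap I J b M (P : set M) q : noetherian R ->
    is_ideal I -> is_ideal J -> baer b P -> is_submod P -> P `<=` killed b ->
    P q -> rad_torsion (I `&` J) q ->
  exists u v, [/\ q = u + v, P u /\ rad_torsion I u & P v /\ rad_torsion J v].
Proof.
move=> nR iI iJ BP sP Pb Pq IJq.
have [L1 [L2 [iL1 iL2 [qL1 qL2] L12 [IL1 JL2]]]] :=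
  radical_cap_split nR iI iJ (annihilatorP q) IJq.
pose G x p := exists l1 l2, [/\ L1 l1, L2 l2, x = l1 + l2 & p = l2 *: q].
have [|||r br|u Pu uP] := BP G.
- split.
  + by exists 0, 0; rewrite scale0r addr0; split=> //; exact: ideal0.
  + move=> _ _ _ _ [y [c [Ky Cc -> ->]]] [y' [c' [Ky' Cc' -> ->]]].
    exists (y + y'), (c + c'); rewrite scalerDl addrACA.
    by split=> //; exact: idealD.
  + move=> r _ _ [y [c [Ky Cc -> ->]]]; exists (r * y), (r * c).
    by rewrite mulrDr scalerA; split=> //; exact: ideal_mull.
- by move=> _ _ [l1 [l2 [_ _ _ ->]]]; exact: submodZ.
- move=> p [l1 [l2 [L1l L2l /esym/eqP]]]; rewrite addr_eq0 => /eqP ll ->.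
  apply: L12; split=> //; rewrite -(opprK l2) -ll; exact: idealN.
- exists r, 0; rewrite addr0 scale0r; split=> //; last exact: ideal0.
  by apply: qL1; exact: Pb.
have L1u l : L1 l -> l *: u = 0.
  move=> L1l; apply/esym/uP; exists l, 0; rewrite addr0 scale0r.
  by split=> //; exact: ideal0.
have L2u l : L2 l -> l *: (q - u) = 0.
  move=> L2l; rewrite scalerBr -(uP l (l *: q)) ?subrr //.
  by exists 0, l; rewrite add0r; split=> //; exact: ideal0.
exists u, (q - u); split; first by rewrite addrC subrK.
- by split=> // x /IL1[n L1x]; exists n; exact: L1u.
- by split; [exact: submodB|move=> x /JL2[n L2x]; exists n; exact: L2u].
Qed.

End Submodules.

Arguments killed {R} b {M}.
Arguments rad_torsion {R} a {M}.
Arguments baer {R} b {M}.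

(** * Depth and local cohomology *)

Section GradedComplexes.
Variables (R : comNzRingType) (X : nat -> lmodType R).
Variable d : forall i, {linear X i -> X i.+1}.
Hypothesis dd : forall i x, d i.+1 (d i x) = 0.
Implicit Types (F G : forall i, set (X i)) (b : set R) (y : R) (n m : nat).

Definition subcomplex F : Prop :=
  forall i, is_submod (F i) /\ forall x, F i x -> F i.+1 (d i x).

Definition bnd F i : set (X i) :=
  match i with 0 => [set 0] | j.+1 => d j @` F j end.
Arguments bnd : clear implicits.

Definition exact_at F i : Prop := forall z, F i z -> d i z = 0 -> bnd F i z.

Lemma bndP F i : subcomplex F -> is_submod (bnd F i).
Proof.
move=> sF; case: i => [|i] /=.
  split=> [//|x y -> ->|r x ->] /=; by rewrite ?addr0 ?scaler0.
have [sFi _] := sF i; split=> [|_ _ [x Fx <-] [y Fy <-]|r _ [x Fx <-]].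
- by exists 0; [exact: submod0|exact: linear0].
- by exists (x + y); [exact: submodD|exact: linearD].
- by exists (r *: x); [exact: submodZ|exact: linearZ].
Qed.

(* The long exact sequence of y : F -> F, read off for the kernel of y (with
   [T = [set 1]]) and for the union of the kernels of its powers. *)
Lemma bnd_restrict F (T : set R) y j w : subcomplex F ->
    (forall i v, F i v -> exists t, exists2 v', F i v' & T t /\ t *: (y *: v' - v) = 0) ->
    T 1 -> F j w -> bnd F j (y *: w) ->
  exists2 u, F j u & d j u = d j w /\ exists2 t, T t & (t * y) *: u = 0.
Proof.
move=> sF div T1; have [sFj _] := sF j.
case: j w sFj => [|j] w sFj Fw /=.
  by move=> yw; exists w => //; split=> //; exists 1; rewrite ?mul1r.
(* With y w = d v, divide v by y: w - d v' has the differential of w and is killed by y up to t. *)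
move=> [v Fv dv]; have [t [v' Fv' [Tt tv]]] := div _ _ Fv.
have [_ dF] := sF j; exists (w - d j v'); first by apply: submodB => //; exact: dF.
split; first by rewrite linearB dd subr0.
exists t => //; rewrite -scalerA scalerBr -dv -linearZ -linearB -linearZ.
have -> : t *: (v - y *: v') = - (t *: (y *: v' - v)) by rewrite -opprB scalerN.
by rewrite tv oppr0 linear0.
Qed.

Lemma bnd_restrict_ker F y j w : subcomplex F ->
    (forall i v, F i v -> exists2 v', F i v' & y *: v' = v) ->
    F j w -> bnd F j (y *: w) ->
  exists2 u, F j u & d j u = d j w /\ y *: u = 0.
Proof.
move=> sF div Fw bw.
have [i v /div[v' Fv' e]||u Fu [du [_ -> yu]]] :=
  bnd_restrict (T := [set 1]) sF _ _ Fw bw.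
- by exists 1, v' => //; rewrite e subrr scaler0.
- by [].
- by exists u => //; rewrite mul1r in yu.
Qed.

(** If z = d w and y z = 0, then y w is a cocycle, hence a coboundary, and w can be replaced by an
    element killed by y. *)
Lemma bnd_ker F y i z : subcomplex F ->
    (forall i v, F i v -> exists2 v', F i v' & y *: v' = v) ->
    (forall j, i = j.+1 -> exact_at F j) ->
    bnd F i z -> y *: z = 0 ->
  bnd (fun i => F i `&` [set u | y *: u = 0]) i z.
Proof.
move=> sF div; case: i z => [//|j] z exj [w Fw <-] /= yz.
have [sFj _] := sF j.
have bw : bnd F j (y *: w).
  by apply: exj => //; [exact: submodZ|rewrite linearZ].
by have [u Fu [du yu]] := bnd_restrict_ker sF div Fw bw; exists u.
Qed.

(** The argument of [bnd_ker] for a power y^k killing z. Division by y^k is possible only up to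
    powers of y, which the y-torsion does not notice. *)
Lemma exact_rad_torsion1 F b y n : noetherian R -> is_ideal b -> subcomplex F ->
    (forall i, baer b (F i)) -> (forall i, F i `<=` killed b) ->
    (forall i, (i < n)%N -> exact_at F i) ->
  forall i, (i < n)%N -> exact_at (fun i => F i `&` rad_torsion [set y]) i.
Proof.
move=> nR ib sF BF Fb exF i lt_in z [Fz /(_ y erefl)[k ykz]] dz.
have := exF _ lt_in _ Fz dz; case: i lt_in z Fz ykz dz => [//|i] lt_in z Fz ykz dz.
move=> [w Fw dw]; have [sFi _] := sF i.
have bw : bnd F i (y ^+ k *: w).
  by apply: exF; [exact: ltnW|exact: submodZ|rewrite linearZ dw].
have [j v Fv||u Fu [du [_ [m ->] mw]]] :=
  bnd_restrict (T := [set x | exists m, x = y ^+ m]) sF _ _ Fw bw.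
- have [sFj _] := sF j.
  have [m [v' Fv' e]] := baer_quasi_div y k nR ib (BF j) sFj (@Fb j) Fv.
  by exists (y ^+ m), v' => //; split=> //; exists m.
- by exists 0%N.
- exists u; last by rewrite du.
  by split=> // _ ->; exists (m + k)%N; rewrite /annihilator /= exprD.
Qed.

Lemma subcomplexI F G : subcomplex F -> subcomplex G -> subcomplex (fun i => F i `&` G i).
Proof.
move=> sF sG i; have [sFi dF] := sF i; have [sGi dG] := sG i.
by split; [exact: submodI|move=> x [/dF ? /dG]].
Qed.

Lemma subcomplex_rad_torsion (a : set R) : subcomplex (fun i => rad_torsion a).
Proof. by move=> i; split; [exact: rad_torsionP|move=> x; exact: rad_torsion_lin]. Qed.

Lemma subcomplex_killed b : subcomplex (fun i => killed b).
Proof. by move=> i; split; [exact: killedP|move=> x; exact: killed_lin]. Qed.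

Lemma rad_torsion_cons (M : lmodType R) x (s : seq R) :
  rad_torsion [set` x :: s] = rad_torsion [set x] `&` @rad_torsion R [set` s] M.
Proof.
apply/seteqP; split=> u; first by move=> su; split=> [_ ->|y ys];
  apply: su => /=; rewrite inE ?eqxx // ys orbT.
by move=> [xu su] y /=; rewrite inE => /predU1P[->|]; [exact: xu|exact: su].
Qed.

(** One element of s at a time, since Baer's criterion passes to the torsion. *)
Lemma exact_rad_torsion F b (s : seq R) n : noetherian R -> is_ideal b -> subcomplex F ->
    (forall i, baer b (F i)) -> (forall i, F i `<=` killed b) ->
    (forall i, (i < n)%N -> exact_at F i) ->
  forall i, (i < n)%N -> exact_at (fun i => F i `&` rad_torsion [set` s]) i.
Proof.
move=> nR ib; elim: s F => [|y s IH] F sF BF Fb exF.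
  rewrite (_ : (fun i => F i `&` _) = F) //.
  by apply: functional_extensionality_dep => i; apply/seteqP; split=> [u []//|u Fu]; split.
rewrite (_ : (fun i => F i `&` rad_torsion [set` y :: s]) =
    (fun i => (F i `&` rad_torsion [set y]) `&` rad_torsion [set` s])); last first.
  by apply: functional_extensionality_dep => i; rewrite rad_torsion_cons setIA.
apply: IH.
- by apply: subcomplexI => //; exact: subcomplex_rad_torsion.
- by move=> i; exact: baer_rad_torsion.
- by move=> i u [/Fb].
- exact: (exact_rad_torsion1 nR ib sF BF Fb exF).
Qed.

(* The cohomology of F is R / b, placed in degree m. *)
Definition cyclic_cohomology F m b : Prop :=
  (forall i, i <> m -> exact_at F i) /\
  exists zeta, [/\ F m zeta, d m zeta = 0,
    forall z, F m z -> d m z = 0 -> exists r, bnd F m (z - r *: zeta)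
    & forall r, bnd F m (r *: zeta) -> b r].

(** Long exact sequence of 0 -> ker x -> F -> F -> 0: x is injective on R / b, so that only its
    cokernel R / (b, x) is left, one degree higher. *)
Lemma cyclic_cohomology_step F m b b' x : subcomplex F -> is_ideal b ->
    (forall i, F i `<=` killed b) ->
    (forall i v, F i v -> exists2 v', F i v' & x *: v' = v) ->
    nonzerodivisor_mod b x -> (forall r t, b (r - t * x) -> b' r) ->
    cyclic_cohomology F m b ->
  cyclic_cohomology (fun i => F i `&` [set u | x *: u = 0]) m.+1 b'.
Proof.
move=> sF ib Fb div xb bb' [exF [zeta [Fzeta dzeta zeta_gen zeta_ann]]].
have sFm := (sF _).1.
have bker i z : i <> m.+1 -> bnd F i z -> x *: z = 0 ->
    bnd (fun i => F i `&` [set u | x *: u = 0]) i z.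
  move=> ne_im; apply: bnd_ker => // j ij; apply: exF => jm.
  by apply: ne_im; rewrite ij jm.
have sb i := bndP i sF.
split.
  move=> i ne_im z [Fz /= xz] dz; apply: bker => //.
  (* In degree m, z is r zeta up to a coboundary, and x z = 0 forces x r, hence r, into b, which
     kills zeta. *)
  have [eq_im|ne_im'] := pselect (i = m); last exact: exF.
  rewrite {}eq_im in z Fz xz dz *; have [r br] := zeta_gen _ Fz dz.
  have := submodZ x (sb m) br; rewrite scalerBr xz sub0r -scaleNr scalerA mulNr.
  move=> /zeta_ann bx; have {}bx : b (x * r) by rewrite -(opprK (x * r)); exact: idealN.
  move: br; rewrite (Fb _ _ Fzeta _ (xb _ bx)); by rewrite subr0.
(* The generator in degree m + 1 is d eta, the connecting image of zeta = x eta. *)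
have [eta Feta xeta] := div _ _ Fzeta.
exists (d m eta); split.
- split; first exact: (sF m).2.
  by rewrite /= -linearZ xeta.
- exact: dd.
- move=> z [Fz /= xz] dz.
  have [w Fw dw] : bnd F m.+1 z by apply: exF => // /eqP; rewrite eqn_leq ltnn.
  have [r] : exists r, bnd F m (x *: w - r *: zeta).
    by apply: zeta_gen; [exact: submodZ|rewrite linearZ dw].
  have -> : x *: w - r *: zeta = x *: (w - r *: eta).
    by rewrite scalerBr -xeta !scalerA mulrC.
  have Fwr : F m (w - r *: eta) by apply: submodB => //; exact: submodZ.
  move=> /(bnd_restrict_ker sF div Fwr)[u Fu [du xu]].
  by exists r; exists u; rewrite // du linearB linearZ dw.
- move=> r [w [Fw /= xw] dw].
  have drw : d m (r *: eta - w) = 0 by rewrite linearB dw linearZ subrr.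
  have [t] := zeta_gen _ (submodB (sFm _) (submodZ r (sFm _) Feta) Fw) drw.
  move/(submodZ x (sb m)); rewrite !scalerBr xw subr0 scalerA mulrC -scalerA xeta.
  rewrite scalerA -scalerBl => /zeta_ann.
  by rewrite mulrC; exact: bb'.
Qed.

End GradedComplexes.

Arguments bnd {R X} d F i _.

(** * Regular sequences and torsion in an injective resolution of R *)

Section DepthAndLocalCohomology.
Variables (R : comNzRingType) (nR : noetherian R).
Variable E : injective_resolution R^o.
Implicit Types (b c : set R) (s : seq R) (x y r : R).

Local Notation d := (res_d E).
Local Notation gen s := (ideal_gen [set` s]).

Lemma res_dd i u : d i.+1 (d i u) = 0.
Proof.
have : range (d i) (d i u) by exists u.
by rewrite -res_exactS.
Qed.

Lemma res_exact i z : d i.+1 z = 0 -> exists w, d i w = z.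
Proof.
move=> dz; have : range (d i) z by rewrite -res_exactS.
by case=> w _ <-; exists w.
Qed.

Lemma res_exact_aug z : d 0 z = 0 -> exists r, z = r *: res_aug E 1.
Proof.
move=> dz; have : range (res_aug E) z by rewrite -res_exact0.
by case=> r _ <-; exists r; rewrite -linearZ /= -[in LHS](mulr1 r).
Qed.

Lemma d_res_aug r : d 0 (res_aug E r) = 0.
Proof.
have : range (res_aug E) (res_aug E r) by exists r.
by rewrite -res_exact0.
Qed.

Lemma killed_rcons (M : lmodType R) s x :
  @killed R (gen (rcons s x)) M = killed (gen s) `&` [set u | x *: u = 0].
Proof.
apply/seteqP; split=> u.
  move=> su; split.
    move=> r sr; apply: su; apply: (ideal_gen_le _ sr) => y /=.
    by rewrite mem_rcons inE orbC => ->.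
  by apply: su; apply: sub_ideal_gen; rewrite /= mem_rcons mem_head.
move=> [su xu] z /ideal_gen_rcons[r sz].
rewrite /annihilator /= -(subrK (r * x) z) scalerDl -scalerA xu scaler0 addr0.
exact: su.
Qed.

Lemma baer_killed_res s i : baer (gen s) (killed (gen s) : set (E i)).
Proof.
have := baer_killed (@subset_refl _ _) (injective_baer (b := gen s) (@res_injective _ _ E i)).
by rewrite setTI.
Qed.

Lemma baer_div_regular b (M : lmodType R) (P : set M) x (q : M) : is_ideal b -> baer b P ->
    is_submod P -> P `<=` killed b -> nonzerodivisor_mod b x ->
  P q -> exists2 q', P q' & x *: q' = q.
Proof.
move=> ib BP sP Pb bx Pq.
have [|q' Pq' e] := baer_div (x := x) (n := 0) ib BP sP Pb _ Pq.
  by move=> r; rewrite expr1 expr0 mul1r; exact: bx.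
by exists q' => //; move: e; rewrite expr1 expr0 scale1r.
Qed.

(** The elements of E killed by s form Hom(R / (s), E), so this computes Ext(R / (s), R). The
    induction starts with E, a resolution of R, and each new x cuts out the kernel of x. *)
Lemma regular_cyclic_cohomology s : regular_seq s ->
  cyclic_cohomology d (fun i => killed (gen s)) (size s) (gen s).
Proof.
elim/last_ind: s => [_|s x IH /regular_seq_rcons[reg regx _]].
  have killed0 i : (killed (gen [::]) : set (E i)) = setT.
    apply/seteqP; split=> // u _ r /ideal_gen_nil ->.
    exact: ideal0 (annihilatorP _).
  split.
    case=> [//|i] _ z _ /res_exact[w dw]; exists w => //.
    by rewrite killed0.
  exists (res_aug E 1); rewrite killed0; split=> //; first exact: d_res_aug.
    by move=> z _ /res_exact_aug[r ->]; exists r; exact: subrr.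
  move=> r; rewrite -linearZ /= => aug0; apply/ideal_gen_nil.
  have := @res_aug_inj _ _ E (r *: (1 : R^o)) 0; rewrite linear0 => /(_ aug0).
  by rewrite -[_ *: _]/(r * 1) mulr1.
rewrite size_rcons (_ : (fun i => _) =
    fun i => killed (gen s) `&` [set u : E i | x *: u = 0]); last first.
  by apply: functional_extensionality_dep => i; exact: killed_rcons.
apply: (cyclic_cohomology_step res_dd _ (ideal_genP _)) (IH reg) => //.
- exact: subcomplex_killed.
- by move=> i v.
- move=> i v Kv.
  apply: (baer_div_regular (ideal_genP _) (@baer_killed_res s i) _ _ regx Kv) => //.
  exact: killedP.
- by move=> r t srt; apply/ideal_gen_rcons; exists t.
Qed.

Section Support.
Variables (c : set R) (ic : is_ideal c).

Let G s i : set (E i) := killed (gen s) `&` rad_torsion c.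
Arguments G : clear implicits.

Local Lemma subcomplexG s : subcomplex d (G s).
Proof. by apply: subcomplexI; [exact: subcomplex_killed|exact: subcomplex_rad_torsion]. Qed.

Local Lemma baerG s i : baer (gen s) (G s i).
Proof. by apply: baer_rad_torsion => //; exact: baer_killed_res. Qed.

Local Lemma divG s x i v : nonzerodivisor_mod (gen s) x ->
  G s i v -> exists2 v', G s i v' & x *: v' = v.
Proof.
move=> regx Gv.
apply: (baer_div_regular (ideal_genP _) (@baerG s i) _ _ regx Gv); last by move=> ? [].
by case: (subcomplexG s i).
Qed.

Local Lemma G_rcons s x : G (rcons s x) = fun i => G s i `&` [set u : E i | x *: u = 0].
Proof.
by apply: functional_extensionality_dep => i; rewrite /G killed_rcons setIAC.
Qed.

Local Lemma G_nil : G [::] = fun i => rad_torsion c.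
Proof.
apply: functional_extensionality_dep => i; apply/seteqP; split=> [u []//|u cu]; split=> //.
by move=> r /ideal_gen_nil ->; exact: ideal0 (annihilatorP _).
Qed.

(** The elements killed by s are exact below [size s], and so is their c-torsion. The members of s
    are then dropped from the last on, by lowering the power of x that kills a cocycle. *)
Lemma exact_below_regular s : regular_seq s -> [set` s] `<=` c ->
  forall i, (i < size s)%N -> exact_at d (fun i => rad_torsion c) i.
Proof.
move=> reg sc.
have exG i : (i < size s)%N -> exact_at d (G s) i.
  have [ys cys] := nR ic; move: i.
  have -> : G s = fun i => killed (gen s) `&` rad_torsion [set` ys].
    by apply: functional_extensionality_dep => i; rewrite /G cys rad_torsion_ideal_gen.
  apply: (@exact_rad_torsion _ _ _ res_dd (fun i => killed (gen s)) (gen s)) => //.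
  - exact: ideal_genP.
  - exact: subcomplex_killed.
  - by move=> i; exact: baer_killed_res.
  - by move=> i v.
  - have [exK _] := regular_cyclic_cohomology reg => i lt_is; apply: exK => eq_is.
    by rewrite eq_is ltnn in lt_is.
(* The bound n stays fixed while s gets shorter. *)
rewrite -G_nil; move: (size s) exG => n.
elim/last_ind: s reg sc => [//|s x IH] /regular_seq_rcons[reg regx _] sxc exG.
have cx : c x by apply: sxc; rewrite /= mem_rcons mem_head.
apply: IH => //.
  by move=> y sy; apply: sxc; rewrite /= mem_rcons inE sy orbT.
move=> i lt_in z Gz dz; have [_ /(_ _ cx)[k]] := Gz.
elim: k z Gz dz => [|k IHk] z Gz dz kz.
  move: kz; rewrite /annihilator /= scale1r => ->.
  by apply: submod0; apply: bndP; exact: subcomplexG.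
have sG j := (subcomplexG s j).1.
(* As x kills x^k z, this is d w in positive degree; with w = x^k w', the cocycle z - d w' is killed
   by x^k. *)
have : bnd d (G (rcons s x)) i (x ^+ k *: z).
  apply: exG => //; last by rewrite linearZ_LR dz scaler0.
  rewrite G_rcons; split; first exact: submodZ.
  by rewrite /= scalerA -exprS.
rewrite G_rcons; case: i lt_in z Gz dz kz IHk => [|i] lt_in z Gz dz kz IHk /=.
  by move=> xz; exact: IHk.
move=> [w [Gw _] dw].
have regxk : nonzerodivisor_mod (gen s) (x ^+ k).
  elim: (k) => [r|l IHl r]; first by rewrite mul1r.
  by rewrite exprS -mulrA => /regx/IHl.
have [w' Gw' xw'] := divG regxk Gw.
have Gdw' : G s i.+1 (d i w') := (subcomplexG s i).2 _ Gw'.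
have [|||u Gu du] := IHk (z - d i w'); first exact: submodB.
- by rewrite linearB dz res_dd subrr.
- by rewrite /annihilator /= scalerBr -linearZ xw' dw subrr.
exists (u + w'); first exact: submodD.
by rewrite linearD du subrK.
Qed.

(** Exactness would pass to the c-torsion of the elements killed by s. There r zeta, which c kills,
    would be a coboundary, against r not in (s). *)
Lemma not_exact_at_regular s r : regular_seq s -> [set` s] `<=` c ->
    ~ gen s r -> (forall y, c y -> gen s (y * r)) ->
  ~ forall i, (i <= size s)%N -> exact_at d (fun i => rad_torsion c) i.
Proof.
move=> reg sc nsr csr exc.
have [_ [zeta [Kzeta dzeta _ zeta_ann]]] := regular_cyclic_cohomology reg.
suff exG i : (i <= size s)%N -> exact_at d (G s) i.
  apply: nsr; apply: zeta_ann.
  have : bnd d (G s) (size s) (r *: zeta).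
    apply: exG => //; last by rewrite linearZ_LR dzeta scaler0.
    split; first exact: (submodZ _ (@killedP _ _ _) Kzeta).
    move=> y cy; exists 1%N; rewrite expr1 /annihilator /= scalerA.
    exact: (Kzeta _ (csr _ cy)).
  by case: (size s) (r *: zeta) => [//|j] _ [w [Kw _] <-]; exists w.
rewrite -G_nil in exc; move: (size s) exc i {r nsr csr zeta Kzeta dzeta zeta_ann} => n exc.
elim/last_ind: s reg sc => [//|s x IH] /regular_seq_rcons[reg regx _] sxc.
have {}IH := IH reg; have {}IH : forall i, (i <= n)%N -> exact_at d (G s) i.
  by apply: IH => y sy; apply: sxc; rewrite /= mem_rcons inE sy orbT.
move=> i le_in; rewrite G_rcons => z [Gz /= xz] dz.
apply: (bnd_ker res_dd (subcomplexG s)) => //.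
- by move=> j v; exact: divG.
- by move=> j ij; apply: IH; rewrite ij in le_in; exact: ltnW.
- exact: IH.
Qed.

End Support.

(** The c-torsion is exact below the length of any regular sequence in c, but not up to the length
    of a maximal one. *)
Lemma has_depth_of_maximal c s : is_proper_ideal c ->
  maximal_regular_seq_in c s -> has_depth c (size s).
Proof.
move=> pc smax; have [ic c1] := pc; split; first by exists s.
have key s1 s2 : maximal_regular_seq_in c s1 -> maximal_regular_seq_in c s2 ->
    (size s1 <= size s2)%N.
  move=> [s1c reg1 _] s2max; have [s2c reg2 _] := s2max.
  have [r nr cr] := maximal_regular_seq_ann nR pc s2max.
  rewrite leqNgt; apply/negP => lt21.
  apply: (not_exact_at_regular reg2 s2c nr cr) => i le_i2.
  by apply: (exact_below_regular ic reg1 s1c); exact: leq_ltn_trans lt21.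
by move=> s' s'max; apply/eqP; rewrite eqn_leq !key.
Qed.

End DepthAndLocalCohomology.

(** * Iterated cones *)

Section Cone.
Variables (R : comNzRingType) (V : lmodType R) (x : R) (d : {linear V -> V}).

(** The tensor product with the Koszul complex R -> R of x. A complex is a single module with an
    endomorphism, so that iteration involves no degrees. *)
Definition cone_d (p : V * V) : V * V := (d p.1, x *: p.1 - d p.2).

Fact cone_d_linear : linear cone_d.
Proof.
move=> r [u v] [u' v']; rewrite /cone_d /=; congr (_, _); first exact: linearP.
rewrite linearP scalerDr scalerA mulrC -scalerA /= scalerBr.
by rewrite opprD addrACA.
Qed.

HB.instance Definition _ :=
  GRing.isLinear.Build R (V * V)%type (V * V)%type _ cone_d cone_d_linear.

Lemma cone_dd : (forall v, d (d v) = 0) -> forall p, cone_d (cone_d p) = 0.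
Proof.
move=> dd [u v]; rewrite /cone_d /=; congr (_, _); first exact: dd.
by rewrite linearB linearZ dd subr0 subrr.
Qed.

End Cone.

Section Splitting.
Variable R : comNzRingType.
Implicit Types (V : lmodType R) (xs : seq R) (x : R).

Definition square_set V (P : set V) : set (V * V)%type := [set p | P p.1 /\ P p.2].

Lemma submod_square V (P : set V) : is_submod P -> is_submod (square_set P).
Proof.
move=> sP; split=> [|p q [? ?] [? ?]|r p [? ?]]; split;
  by [exact: submod0|exact: submodD|exact: submodZ].
Qed.

Definition d_stable V (d : V -> V) (P : set V) : Prop := forall v, P v -> P (d v).

Lemma d_stable_square V (d : {linear V -> V}) x (P : set V) : is_submod P ->
  d_stable d P -> d_stable (cone_d x d) (square_set P).
Proof.
move=> sP dP p [P1 P2]; split=> /=; first exact: dP.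
by apply: submodB => //; [exact: submodZ|exact: dP].
Qed.

(* [P' `<=` P] and P / P' has no cohomology. *)
Definition quasi_iso V (d : V -> V) (P P' : set V) : Prop :=
  P' `<=` P /\ forall y, P y -> P' (d y) -> exists2 w, P w & P' (y - d w).

Lemma quasi_iso_trans V (d : {linear V -> V}) (P P' P'' : set V) :
    (forall v, d (d v) = 0) -> is_submod P ->
  quasi_iso d P P' -> quasi_iso d P' P'' -> quasi_iso d P P''.
Proof.
move=> dd sP [P'P exP] [P''P' exP']; split; first exact: subset_trans P'P.
move=> y Py P''dy; have [w Pw P'w] := exP _ Py (P''P' _ P''dy).
have [|w' P'w' P''w] := exP' _ P'w; first by rewrite linearB dd subr0.
exists (w + w'); first by apply: submodD => //; exact: P'P.
by rewrite linearD opprD addrA.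
Qed.

Lemma quasi_iso_cone V (d : {linear V -> V}) x (P P' : set V) :
    (forall v, d (d v) = 0) -> is_submod P -> is_submod P' -> d_stable d P ->
  quasi_iso d P P' -> quasi_iso (cone_d x d) (square_set P) (square_set P').
Proof.
move=> dd sP sP' dP [P'P exP]; split; first by move=> p [/P'P ? /P'P].
move=> [a b] [/= Pa Pb] [/= P'a P'b].
have [w Pw P'w] := exP _ Pa P'a.
have [||w' Pw' P'w'] := exP (b - x *: w).
- by apply: submodB => //; exact: submodZ.
- rewrite linearB linearZ.
  have -> : d b - x *: d w = x *: (a - d w) - (x *: a - d b).
    by rewrite scalerBr opprB [RHS]addrC addrA subrK.
  by apply: submodB => //; exact: submodZ.
exists (w, - w'); first by split=> //; exact: submodN.
by split=> //=; rewrite linearN opprK opprD addrA.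
Qed.

(* Over the cone of [x], multiplication by [x] is null-homotopic, so that
   P / P' loses its cohomology when [x] acts bijectively on it. *)
Lemma quasi_iso_cone_bij V (d : {linear V -> V}) x (P P' : set V) :
    is_submod P -> is_submod P' -> d_stable d P' -> P' `<=` P ->
    (forall q, P q -> P' (x *: q) -> P' q) ->
    (forall q, P q -> exists2 q', P q' & P' (x *: q' - q)) -> d_stable d P ->
  quasi_iso (cone_d x d) (square_set P) (square_set P').
Proof.
move=> sP sP' dP' P'P xinj xsurj dP; split; first by move=> p [/P'P ? /P'P].
(* The null homotopy sends (a, b) to (w, 0), where x w = b modulo P'. *)
move=> [a b] [/= Pa Pb] [/= P'a P'b]; have [w Pw P'w] := xsurj _ Pb.
exists (w, 0); first by split=> //; exact: submod0.
split=> /=; last first.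
  rewrite linear0 subr0 -opprB; exact: submodN.
apply: xinj; first by apply: submodB => //; exact: dP.
have -> : x *: (a - d w) = (x *: a - d b) - d (x *: w - b).
  by rewrite scalerBr (linearB d) (linearZ_LR d) opprB addrA subrK.
by apply: submodB => //; exact: dP'.
Qed.

(* P = P_0 >= P_1 >= ... >= P_r = C with x_j bijective on P_(j-1) / P_j; the
   model is P_j = elements of P torsion with respect to x_1, ..., x_j. *)
Fixpoint bij_filtration xs V (d : V -> V) (P C : set V) : Prop :=
  if xs is x :: xs' then
    exists P', [/\ is_submod P', d_stable d P', P' `<=` P,
      (forall q, P q -> P' (x *: q) -> P' q) /\
      (forall q, P q -> exists2 q', P q' & P' (x *: q' - q))
      & bij_filtration xs' d P' C]
  else P = C.

Lemma bij_filtration_square xs V (d : {linear V -> V}) x (P C : set V) :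
  bij_filtration xs d P C -> bij_filtration xs (cone_d x d) (square_set P) (square_set C).
Proof.
elim: xs P => [P -> //|y xs IH] P [P' [sP' dP' P'P [yinj ysurj] fil]].
exists (square_set P'); split; [exact: submod_square|exact: d_stable_square| | |exact: IH].
  by move=> p [/P'P ? /P'P].
split; first by move=> q [? ?] [? ?]; split; apply: yinj.
move=> q [/ysurj[u Pu P'u] /ysurj[v Pv P'v]].
by exists (u, v).
Qed.

(** * Splitting the class of 1 over the iterated cones *)

Variables (a : set R) (f g : R).

(* The relation [tau v c] says that [v] lies in the subcomplex generated by the
   Koszul complex of R and that its component in top degree is c modulo [a].
   [C] is the [a]-torsion, [T] a truncation of it, and [Y] lifts [T] to pairs
   of an element of g-torsion and one of f-torsion. *)
Record split_data xs V (d : {linear V -> V}) (tau : V -> R -> Prop) (P C T : set V)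
    (Y : V -> V -> Prop) : Prop := SplitData {
  sd_dd : forall v, d (d v) = 0;
  sd_tau0 : tau 0 0;
  sd_tauD : forall u v r s, tau u r -> tau v s -> tau (u + v) (r + s);
  sd_tauZ : forall t u r, tau u r -> tau (t *: u) (t * r);
  sd_tau_stable : forall u r, tau u r -> exists s, tau (d u) s;
  sd_tau_d : forall u r s, tau u r -> tau (d u) s -> a s;
  sd_tau1 : exists2 z, tau z 1 & d z = 0;
  sd_tau_qiso : quasi_iso d setT [set v | exists r, tau v r];
  sd_P : is_submod P;
  sd_P_stable : d_stable d P;
  sd_P_qiso : quasi_iso d setT P;
  sd_fil : bij_filtration xs d P C;
  sd_C : is_submod C;
  sd_C_stable : d_stable d C;
  sd_T : is_submod T;
  sd_T_qiso : quasi_iso d C T;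
  sd_Y0 : Y 0 0;
  sd_YD : forall u v u' v', Y u v -> Y u' v' -> Y (u + u') (v + v');
  sd_YZ : forall r u v, Y u v -> Y (r *: u) (r *: v);
  sd_Y_stable : forall u v, Y u v -> Y (d u) (d v);
  sd_Y_surj : forall t, T t -> exists u v, Y u v /\ t = u + v;
  sd_Y_acyclic : forall w, Y w (- w) -> d w = 0 -> exists2 w', Y w' (- w') & w = d w';
  sd_Y_tors : forall u v, Y u v ->
    (exists n, g ^+ n *: u = 0) /\ (exists n, f ^+ n *: v = 0)
}.

(** The cone uses up the first step of the filtration. The top component of a pair is that of its
    second entry; for a coboundary it stays in a, because x is in a. *)
Lemma split_data_cone x xs V d tau (P C T : set V) Y : is_ideal a -> a x ->
    @split_data (x :: xs) V d tau P C T Y ->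
  exists P', @split_data xs (V * V)%type (cone_d x d)
    (fun p c => (exists r, tau p.1 r) /\ tau p.2 c)
    P' (square_set C) (square_set T) (fun p q => Y p.1 q.1 /\ Y p.2 q.2).
Proof.
move=> ia ax [dd tau0 tauD tauZ taud tau_a [z tz dz] qtau sP dP qP
  [P' [sP' dP' P'P [xinj xsurj] fil]] sC dC sT qT Y0 YD YZ Yd Ysurj Yex Ytors].
have sS : is_submod [set v | exists r, tau v r].
  split=> [|u v [r ur] [s vs]|t u [r ur]]; first by exists 0.
    by exists (r + s); exact: tauD.
  by exists (t * r); exact: tauZ.
exists (square_set P'); split.
- exact: cone_dd.
- by split=> //; exists 0.
- move=> p q r s [[r1 p1] p2] [[s1 q1] q2]; split; last exact: tauD.
  by exists (r1 + s1); exact: tauD.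
- move=> t p r [[r1 p1] p2]; split; last exact: tauZ.
  by exists (t * r1); exact: tauZ.
- move=> [u v] r [/= [r1 ur1] vr]; have [s1 us1] := taud _ _ ur1.
  have [s vs] := taud _ _ vr; exists (x * r1 + (-1) * s); split; first by exists s1.
  by rewrite -scaleN1r; apply: tauD; exact: tauZ.
- move=> [u v] r s [/= [r1 ur1] vr] [_ /= us].
  have : a (s + (-1) * (x * r1)).
    apply: (tau_a (- v) ((-1) * r)); first by rewrite -scaleN1r; exact: tauZ.
    have -> : d (- v) = (x *: u - d v) + (-1) *: (x *: u).
      by rewrite linearN scaleN1r addrAC subrr add0r.
    by apply: tauD => //; exact/tauZ/tauZ.
  rewrite mulN1r => asx; rewrite -(subrK (x * r1) s); apply: idealD => //.
  exact: ideal_mulr.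
- exists (0, z); first by split=> //; exists 0.
  by rewrite -[LHS]/(d 0, x *: 0 - d z) linear0 scaler0 dz subr0.
- have [_ exS] : quasi_iso (cone_d x d) (square_set setT)
      (square_set [set v | exists r, tau v r]) by exact: quasi_iso_cone.
  split=> // p _ [r [pr1 pr2]]; have [||w _ [S1 [r' S2]]] := exS p.
  + by [].
  + by split=> //; exists r.
  + by exists w => //; exists r'.
- exact: submod_square.
- exact: d_stable_square.
(* The passage to P x P is the cone of the given one; that to P' x P' holds because x is bijective
   on P / P'. *)
- apply: (@quasi_iso_trans _ _ _ (square_set P)) => //.
  + exact: cone_dd.
  + have [_ exP] : quasi_iso (cone_d x d) (square_set setT) (square_set P).
      exact: quasi_iso_cone.
    by split=> // p _ Pp; have [//|//|w _ Pw] := exP p; exists w.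
  + exact: quasi_iso_cone_bij.
- exact: bij_filtration_square.
- exact: submod_square.
- exact: d_stable_square.
- exact: submod_square.
- exact: quasi_iso_cone.
- by [].
- by move=> u v u' v' [? ?] [? ?]; split; exact: YD.
- by move=> r u v [? ?]; split; exact: YZ.
- move=> [u1 u2] [v1 v2] [/= Y1 Y2]; split=> /=; first exact: Yd.
  by rewrite -!scaleN1r; apply: YD; apply: YZ => //; exact: Yd.
- move=> [t1 t2] [/= /Ysurj[u1 [v1 [Y1 ->]]] /Ysurj[u2 [v2 [Y2 ->]]]].
  by exists (u1, u2), (v1, v2).
- move=> [w1 w2] [/= Y1 Y2] [dw1 dw2].
  have [w Yw w1E] := Yex _ Y1 dw1.
  have [||w' Yw' w2E] := Yex (w2 - x *: w).
  + have := YD _ _ _ _ Y2 (YZ (- x) _ _ Yw).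
    by rewrite !scaleNr -opprD scalerN.
  + by rewrite linearB linearZ -w1E; apply/eqP; rewrite subr_eq0 eq_sym -subr_eq0 dw2.
  exists (w, - w').
    by split=> //=; have := YZ (-1) _ _ Yw'; rewrite !scaleN1r.
  by rewrite -[RHS]/(d w, x *: w - d (- w')) -w1E linearN opprK -w2E addrC subrK.
- move=> [u1 u2] [v1 v2] [/= /Ytors[[n1 n1P] [m1 m1P]] /Ytors[[n2 n2P] [m2 m2P]]].
  have pow (h : R) k l (v : V) : h ^+ k *: v = 0 -> h ^+ (l + k) *: v = 0.
    by rewrite exprD -scalerA => ->; rewrite scaler0.
  split; [exists (n1 + n2)%N|exists (m1 + m2)%N]; congr (_, _) => /=;
    by [exact: pow|rewrite addnC; exact: pow].
Qed.

Fact addr_regroup (V : zmodType) (t p q A B C D z : V) :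
  z = t + A + B -> t = p + q -> z - (p - C) - (q - D) = A + B + C + D.
Proof.
move=> -> ->; rewrite !opprB -[p + q + A + B]addrA -[p + q + _]addrA.
rewrite [p + _]addrC [_ + (C - p)]addrACA subrr addr0 -[q + _ + C]addrA [q + _]addrC.
by rewrite addrACA subrr addr0.
Qed.

(** Now P = C, so coboundaries move the cocycle z into C and then into T, where it splits as u + v.
    After a correction both parts are cocycles; e and e' are the top components of Koszul elements
    cohomologous to them. *)
Lemma split_data_nil V d tau (P C T : set V) Y : is_ideal a ->
    @split_data [::] V d tau P C T Y ->
  exists e e' n, [/\ a (1 - e - e'), a (g ^+ n * e) & a (f ^+ n * e')].
Proof.
move=> ia [dd tau0 tauD tauZ taud tau_a [z tz dz] [_ exS] sP dP [_ exP] /=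
  PC sC dC sT [TC exT] Y0 YD YZ Yd Ysurj Yex Ytors].
have tauN u r : tau u r -> tau (- u) (- r).
  by move=> ur; rewrite -scaleN1r -[- r]mulN1r; exact: tauZ.
(* A Koszul element that is a coboundary is one within the Koszul complex, so its top component is
   in a. *)
have tau_bnd u r w : tau u r -> u = d w -> a r.
  move=> ur uw; have [//||w' _ [s wws]] := exS w; first by exists r; rewrite -uw.
  by apply: tau_a wws _; rewrite linearB dd subr0 -uw.
have [//||w0 _ Pw0] := exP z; first by rewrite dz; exact: submod0.
have [||w1 _ Tw1] := exT (z - d w0); first by rewrite -PC.
  by rewrite linearB dd dz subrr; exact: submod0.
have [u [v [Yuv uvE]]] := Ysurj _ Tw1.
have dudv : d u = - d v.
  apply/eqP; rewrite -addr_eq0 -linearD -uvE !linearB !dd dz !subr0; exact/eqP.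
(* As d u = - d v, acyclicity gives d u = d w with w, -w a pair in Y; then u - w and v + w are
   cocycles. *)
have [||w Yw duw] := Yex (d u); last 1 first.
- have Yuw : Y (u - w) (v + w).
    have := YD _ _ _ _ Yuv (YZ (-1) _ _ Yw).
    by rewrite !scaleN1r opprK.
  have [[n nu] [m mv]] := Ytors _ _ Yuw.
  have du0 : d (u - w) = 0 by rewrite linearB -duw; exact: subrr.
  have dv0 : d (v + w) = 0 by rewrite linearD -duw dudv; exact: subrr.
  have [//||wu _ [e eP]] := exS (u - w); first by rewrite du0; exists 0.
  have [//||wv _ [e' e'P]] := exS (v + w); first by rewrite dv0; exists 0.
  exists e, e', (n + m)%N; split.
  + have := tauD _ _ _ _ (tauD _ _ _ _ tz (tauN _ _ eP)) (tauN _ _ e'P).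
    move=> /(tau_bnd _ _ (w1 + w0 + wu + wv)); apply; rewrite !(linearD d).
    apply: addr_regroup; first by rewrite -(subrK (d w0) z) -(subrK (d w1) (z - _)) uvE.
    by rewrite addrACA addNr addr0.
  + apply: (tau_bnd _ _ (- (g ^+ (n + m) *: wu)) (tauZ _ _ _ eP)).
    have gu : g ^+ (n + m) *: (u - w) = 0 by rewrite addnC exprD -scalerA nu scaler0.
    by rewrite scalerBr gu sub0r (linearN d) (linearZ_LR d).
  + apply: (tau_bnd _ _ (- (f ^+ (n + m) *: wv)) (tauZ _ _ _ e'P)).
    have fv : f ^+ (n + m) *: (v + w) = 0 by rewrite exprD -scalerA mv scaler0.
    by rewrite scalerBr fv sub0r (linearN d) (linearZ_LR d).
- by rewrite {2}dudv opprK; exact: Yd.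
- exact: dd.
Qed.

Lemma split_data_elements xs V d tau (P C T : set V) Y : is_ideal a -> [set` xs] `<=` a ->
    @split_data xs V d tau P C T Y ->
  exists e e' n, [/\ a (1 - e - e'), a (g ^+ n * e) & a (f ^+ n * e')].
Proof.
move=> ia; elim: xs V d tau P C T Y => [|x xs IH] V d tau P C T Y xsa data.
  exact: split_data_nil data.
have ax : a x by apply: xsa; exact: mem_head.
have [P' data'] := split_data_cone ia ax data.
by apply: IH data' => y ys; apply: xsa; rewrite /= inE ys orbT.
Qed.

End Splitting.

(** * The splitting for an injective resolution *)

Section ProductModule.
Variables (R : comNzRingType) (X : nat -> lmodType R).

(** Turns a complex into one module, as the cones require. In the product, elements can be chosen
    degree by degree. *)
Definition prod_mod : Type := forall i, X i.

HB.instance Definition _ := gen_eqMixin prod_mod.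
HB.instance Definition _ := gen_choiceMixin prod_mod.

Implicit Types u v w : prod_mod.

Lemma prod_modP u v : (forall i, u i = v i) -> u = v.
Proof. exact: functional_extensionality_dep. Qed.

Definition prod_zero : prod_mod := fun i => 0.
Definition prod_add u v : prod_mod := fun i => u i + v i.
Definition prod_opp u : prod_mod := fun i => - u i.
Definition prod_scale (r : R) u : prod_mod := fun i => r *: u i.

Fact prod_addA : associative prod_add.
Proof. by move=> u v w; apply: prod_modP => i; exact: addrA. Qed.
Fact prod_addC : commutative prod_add.
Proof. by move=> u v; apply: prod_modP => i; exact: addrC. Qed.
Fact prod_add0 : left_id prod_zero prod_add.
Proof. by move=> u; apply: prod_modP => i; exact: add0r. Qed.
Fact prod_addN : left_inverse prod_zero prod_opp prod_add.
Proof. by move=> u; apply: prod_modP => i; exact: addNr. Qed.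

HB.instance Definition _ :=
  GRing.isZmodule.Build prod_mod prod_addA prod_addC prod_add0 prod_addN.

Fact prod_scaleA r s u : prod_scale r (prod_scale s u) = prod_scale (r * s) u.
Proof. by apply: prod_modP => i; exact: scalerA. Qed.
Fact prod_scale1 : left_id 1 prod_scale.
Proof. by move=> u; apply: prod_modP => i; exact: scale1r. Qed.
Fact prod_scaleDr : right_distributive prod_scale +%R.
Proof. by move=> r u v; apply: prod_modP => i; exact: scalerDr. Qed.
Fact prod_scaleDl u : {morph prod_scale^~ u : r s / r + s}.
Proof. by move=> r s; apply: prod_modP => i; exact: scalerDl. Qed.

HB.instance Definition _ := GRing.Zmodule_isLmodule.Build R prod_mod
  prod_scaleA prod_scale1 prod_scaleDr prod_scaleDl.

Lemma prodD u v i : (u + v) i = u i + v i. Proof. by []. Qed.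
Lemma prodB u v i : (u - v) i = u i - v i. Proof. by []. Qed.
Lemma prodZ (r : R) u i : (r *: u) i = r *: u i. Proof. by []. Qed.

Lemma prod_choice (Q : forall i, X i -> Prop) :
  (forall i, exists x, Q i x) -> exists u : prod_mod, forall i, Q i (u i).
Proof. by move=> exQ; exists (fun i => sval (cid (exQ i))) => i; case: cid. Qed.

Definition prod_set (F : forall i, set (X i)) : set prod_mod :=
  [set u | forall i, F i (u i)].

Lemma submod_prod F : (forall i, is_submod (F i)) -> is_submod (prod_set F).
Proof.
move=> sF; split=> [i|u v Fu Fv i|r u Fu i]; have := sF i;
  by [exact: submod0|move=> sFi; exact: submodD|move=> sFi; exact: submodZ].
Qed.

Variable d : forall i, {linear X i -> X i.+1}.
Hypothesis dd : forall i x, d i.+1 (d i x) = 0.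

Definition prod_d u : prod_mod := fun i => if i is j.+1 then d j (u j) else 0.

Fact prod_d_linear : linear prod_d.
Proof.
move=> r u v; apply: prod_modP => -[|i] /=; last exact: linearP.
by rewrite prodD prodZ /= scaler0 addr0.
Qed.
HB.instance Definition _ := GRing.isLinear.Build R prod_mod prod_mod _ prod_d prod_d_linear.

Lemma prod_dd u : prod_d (prod_d u) = 0.
Proof. by apply: prod_modP => -[//|[|i]]; [exact: linear0|exact: dd]. Qed.

Lemma d_stable_prod F : subcomplex d F -> d_stable prod_d (prod_set F).
Proof.
move=> sF u Fu [|i] /=; first by apply: submod0; case: (sF 0%N).
by have [_] := sF i; apply; exact: Fu.
Qed.

(** Modulo the x-torsion, x is injective, and by [baer_quasi_div] it is surjective. *)
Lemma bij_filtration_prod (b : set R) xs F : noetherian R -> is_ideal b ->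
    subcomplex d F -> (forall i, baer b (F i)) -> (forall i, F i `<=` killed b) ->
  bij_filtration xs prod_d (prod_set F) (prod_set (fun i => F i `&` rad_torsion [set` xs])).
Proof.
move=> nR ib; elim: xs F => [|x xs IH] F sF BF Fb /=.
  congr prod_set; apply: functional_extensionality_dep => i.
  by apply/seteqP; split=> [u Fu|u []//]; split.
have sG : subcomplex d (fun i => F i `&` rad_torsion [set x]).
  by apply: subcomplexI => //; exact: subcomplex_rad_torsion.
exists (prod_set (fun i => F i `&` rad_torsion [set x])); split.
- by apply: submod_prod => i; exact: (sG i).1.
- exact: d_stable_prod.
- by move=> u Gu i; case: (Gu i).
- split=> [u Fu Gu i|u Fu].
    split; first exact: Fu.
    move=> _ ->; have [_ /(_ x erefl)[k kxu]] := Gu i; exists k.+1.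
    by move: kxu; rewrite /annihilator /= prodZ scalerA -exprSr.
  have div i : exists p, F i p /\ exists n, x ^+ n *: (x *: p - u i) = 0.
    have [n [v Fv e]] := baer_quasi_div x 1 nR ib (BF i) (sF i).1 (@Fb i) (Fu i).
    by exists v; split=> //; exists n; rewrite expr1 in e.
  have [v vP] := prod_choice div; exists v; first by move=> i; case: (vP i).
  move=> i; have [Fv [n xn]] := vP i; split; last by move=> _ ->; exists n.
  have [sFi _] := sF i; rewrite prodB prodZ; apply: submodB => //.
  exact: submodZ.
- have := IH _ sG; rewrite (_ : (fun i => F i `&` rad_torsion [set` x :: xs]) =
    (fun i => (F i `&` rad_torsion [set x]) `&` rad_torsion [set` xs])).
    apply; last by move=> i u [/Fb].
    by move=> i; exact: baer_rad_torsion.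
  by apply: functional_extensionality_dep => i; rewrite rad_torsion_cons setIA.
Qed.

(** Finitely many nonzero components have a common exponent; the truncation of the pairs ensures
    this finiteness. *)
Lemma prod_torsion_bounded (x : R) n u : (forall i, rad_torsion [set x] (u i)) ->
  (forall i, (n < i)%N -> u i = 0) -> exists k, x ^+ k *: u = 0.
Proof.
move=> xu un.
have [k kP] : exists k, forall i, (i <= n)%N -> x ^+ k *: u i = 0.
  elim: (n) => [|j [k kP]].
    have [k ku] := xu 0%N x erefl; exists k => i.
    by rewrite leqn0 => /eqP ->.
  have [l lu] := xu j.+1 x erefl; exists (k + l)%N => i.
  rewrite leq_eqVlt => /predU1P[->|]; first by rewrite exprD -scalerA lu scaler0.
  by rewrite ltnS => /kP e; rewrite addnC exprD -scalerA e scaler0.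
exists k; apply: prod_modP => i; rewrite prodZ.
by have [/kP //|/un ->] := leqP i n; exact: scaler0.
Qed.

End ProductModule.

(** * Truncations and the Mayer-Vietoris sequence *)

Section Main.
Variables (R : comNzRingType) (nR : noetherian R).
Variable E : injective_resolution R^o.
Variables (I J : set R) (iI : is_ideal I) (iJ : is_ideal J) (h : nat).
Hypothesis cd_le : forall i, (h < i)%N -> local_cohomology_zero E (I `&` J) i.
Hypothesis exIJ : forall i, (i <= h.+1)%N ->
  exact_at (res_d E) (fun i => rad_torsion (ideal_sum I J)) i.

Local Notation d := (res_d E).
Local Notation W := (prod_mod E).
Local Notation a := (I `&` J).
Implicit Types (u v w t y : W) (r s : R).

(** The relation [tau] before any cone: the Koszul complex is R, embedded in degree 0 by the
    augmentation. *)
Definition koszul_top w r : Prop :=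
  w 0%N = res_aug E r /\ forall i, w i.+1 = 0.

Definition trunc_cap : set W := [set w | [/\ prod_set (fun i => rad_torsion a) w,
  d h (w h) = 0 & forall i, (h < i)%N -> w i = 0]].

(* Pairs with sum in [trunc_cap]; those of sum zero form the truncation in
   degrees <= h + 1 of the torsion with respect to I + J. *)
Definition trunc_pair u v : Prop :=
  [/\ forall i, rad_torsion I (u i), forall i, rad_torsion J (v i),
    d h (u h + v h) = 0, forall i, (h < i)%N -> u i + v i = 0
    & d h.+1 (u h.+1) = 0 /\ forall i, (h.+1 < i)%N -> u i = 0].

Lemma trunc_pairD u v u' v' :
  trunc_pair u v -> trunc_pair u' v' -> trunc_pair (u + u') (v + v').
Proof.
move=> [Iu Jv duv uv [du u0]] [Iu' Jv' duv' uv' [du' u0']].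
split=> [i|i||i lt_hi|]; first exact: (submodD (rad_torsionP _ _) (Iu i) (Iu' i)).
- exact: (submodD (rad_torsionP _ _) (Jv i) (Jv' i)).
- by rewrite !prodD addrACA linearD duv duv' addr0.
- by rewrite !prodD addrACA uv // uv' // addr0.
- split=> [|i lt_hi]; first by rewrite prodD linearD du du' addr0.
  by rewrite prodD u0 // u0' // addr0.
Qed.

Lemma trunc_pairZ r u v : trunc_pair u v -> trunc_pair (r *: u) (r *: v).
Proof.
move=> [Iu Jv duv uv [du u0]].
split=> [i|i||i lt_hi|]; first exact: (submodZ _ (rad_torsionP _ _) (Iu i)).
- exact: (submodZ _ (rad_torsionP _ _) (Jv i)).
- by rewrite !prodZ -scalerDr linearZ_LR duv scaler0.
- by rewrite !prodZ -scalerDr uv // scaler0.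
- split=> [|i lt_hi]; first by rewrite prodZ linearZ_LR du scaler0.
  by rewrite prodZ u0 // scaler0.
Qed.

Lemma trunc_pair_stable u v : trunc_pair u v -> trunc_pair (prod_d d u) (prod_d d v).
Proof.
move=> [Iu Jv duv uv [du u0]].
have dsum j : (h <= j)%N -> d j (u j + v j) = 0.
  rewrite leq_eqVlt => /predU1P[<- //|/uv ->]; exact: linear0.
split=> [[|i]|[|i]||[//|i] lt_hi|] /=.
- exact: (submod0 (rad_torsionP _ _)).
- exact: rad_torsion_lin.
- exact: (submod0 (rad_torsionP _ _)).
- exact: rad_torsion_lin.
- by case: (h) => [|j] /=; rewrite ?addr0 ?linear0 // linearD !res_dd addr0.
- by rewrite -linearD dsum.
- split; first exact: res_dd.
  move=> [//|i]; rewrite ltnS leq_eqVlt => /predU1P[<- //|/u0 /= ->].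
  exact: linear0.
Qed.

(** Each component splits by [baer_rad_torsion_cap] with b = 0; above degree h both parts are taken
    to be 0. *)
Lemma trunc_pair_surj t : trunc_cap t -> exists u v, trunc_pair u v /\ t = u + v.
Proof.
move=> [at_ dt t0].
have split_t i : exists p, [/\ rad_torsion I p, rad_torsion J (t i - p)
    & (h < i)%N -> p = 0].
  have [lt_hi|le_ih] := ltnP h i.
    exists 0; rewrite t0 // subr0; split=> //; exact: (submod0 (rad_torsionP _ _)).
  have [|u [v [-> [_ Iu] [_ Jv]]]] := baer_rad_torsion_cap (b := [set 0]) (P := setT) nR
    iI iJ (injective_baer (@res_injective _ _ E i)) (submodT _) _ Logic.I (at_ i).
    by move=> u _ r ->; exact: scale0r.
  by exists u; rewrite addrC addKr.
have [u uP] := prod_choice split_t.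
exists u, (t - u); split; last by rewrite addrC subrK.
have u0 i : (h < i)%N -> u i = 0 by case: (uP i).
split=> [i|i||i lt_hi|].
- by case: (uP i).
- by case: (uP i).
- by rewrite prodB addrC subrK.
- by rewrite prodB u0 // t0 // subr0 addr0.
- split=> [|i /ltnW/u0 //]; by rewrite u0 // linear0.
Qed.

(** Here w is both I- and J-torsion, hence (I + J)-torsion, and lives in degrees at most h + 1,
    where that complex is exact. The preimage can be taken 0 above degree h. *)
Lemma trunc_pair_acyclic w : trunc_pair w (- w) -> prod_d d w = 0 ->
  exists2 w', trunc_pair w' (- w') & w = prod_d d w'.
Proof.
move=> [Iw Jw _ _ [_ w0]] dw.
have dwi i : d i (w i) = 0 by rewrite -[LHS]/(prod_d d w i.+1) dw.
have IJw i : rad_torsion (ideal_sum I J) (w i).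
  rewrite rad_torsion_ideal_sum //; split; first exact: Iw.
  rewrite -(opprK (w i)); exact: (submodN (rad_torsionP _ _) (Jw i)).
have bnd_w i : exists p, [/\ rad_torsion (ideal_sum I J) p, (h < i)%N -> p = 0
    & w i.+1 = d i p].
  have [lt_hi|le_ih] := ltnP h i.
    exists 0; rewrite linear0 w0 //; split=> //; exact: (submod0 (rad_torsionP _ _)).
  by have [w' IJw' <-] := exIJ (i := i.+1) le_ih (IJw _) (dwi _); exists w'.
have [w' w'P] := prod_choice bnd_w; exists w'.
  have w'0 i : (h < i)%N -> w' i = 0 by case: (w'P i).
  have Iw' i : rad_torsion I (w' i) /\ rad_torsion J (w' i).
    by case: (w'P i) => + _ _; rewrite rad_torsion_ideal_sum // => -[].
  split=> [i|i||i _|].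
  - by case: (Iw' i).
  - exact: (submodN (rad_torsionP _ _) (Iw' i).2).
  - by rewrite -[X in d h X]/((w' - w') h) subrr linear0.
  - exact: subrr.
  - by split=> [|i /ltnW/w'0 //]; rewrite w'0 // linear0.
apply: prod_modP => -[|i] /=; last by case: (w'P i).
exact: (exIJ (i := 0) (leq0n _) (IJw _) (dwi _)).
Qed.

(** The components of y above degree h are cocycles, hence coboundaries by the vanishing of local
    cohomology. *)
Lemma trunc_cap_quasi_iso :
  quasi_iso (prod_d d) (prod_set (fun i => rad_torsion a)) trunc_cap.
Proof.
split=> [w [] //|y ay [_ _ dy0]].
have dy i : (h <= i)%N -> d i (y i) = 0 by rewrite -ltnS => /dy0.
have bnd_y i : exists p, [/\ rad_torsion a p, (i < h)%N -> p = 0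
    & (h <= i)%N -> y i.+1 = d i p].
  have [lt_ih|le_hi] := ltnP i h.
    by exists 0; split=> //; [exact: (submod0 (rad_torsionP _ _))].
  have [|w aw <-] := @cd_le i.+1 le_hi (y i.+1).
    by split; [rewrite torsionE|exact/dy/ltnW].
  by exists w; split=> //; rewrite -torsionE.
have [w wP] := prod_choice bnd_y.
have sa i : is_submod (rad_torsion a : set (E i)) by exact: rad_torsionP.
exists w; first by move=> i; case: (wP i).
have wh : (y - prod_d d w) h = y h.
  rewrite prodB; case: (h) (wP) => [|j] jP; first exact: subr0.
  by have [_ /(_ (leqnn _)) /= -> _] := jP j; rewrite linear0 subr0.
split; last 2 first.
- by rewrite wh dy.
- by move=> [//|i] lt_hi; have [_ _ /(_ lt_hi) e] := wP i; rewrite prodB /= e subrr.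
move=> [|i]; rewrite prodB; first by rewrite subr0; exact: ay.
apply: (submodB (sa _) (ay _)).
by have [aw _ _] := wP i; exact: rad_torsion_lin.
Qed.

(** The data before any cone: R -> E is a quasi-isomorphism since E resolves R, and the filtration
    runs from E to its a-torsion. *)
Lemma split_data_resolution (f g : R) xs : J f -> I g -> a = ideal_gen [set` xs] ->
  split_data a f g xs (prod_d d) koszul_top setT
    (prod_set (fun i => rad_torsion a)) trunc_cap trunc_pair.
Proof.
move=> Jf Ig axs; have ia : is_ideal a by exact: ideal_capP.
have aug0 : res_aug E 0 = 0 by exact: linear0.
have sa : subcomplex d (fun i => rad_torsion a) by exact: subcomplex_rad_torsion.
split.
- exact/prod_dd/res_dd.
- by split.
- move=> u v r s [u0 uS] [v0 vS]; split=> [|i]; first by rewrite prodD u0 v0 -linearD.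
  by rewrite prodD uS vS addr0.
- move=> t u r [u0 uS]; split=> [|i]; first by rewrite prodZ u0 -linearZ.
  by rewrite prodZ uS scaler0.
- move=> u r [u0 uS]; exists 0; split=> [//|[|i]] /=.
    by rewrite u0 d_res_aug.
  by rewrite uS linear0.
- move=> u r s _ [/= s0 _].
  rewrite (@res_aug_inj _ _ E s 0) -?s0 //; exact: (ideal0 ia).
- exists (fun i => if i is 0 then res_aug E 1 else 0); first by split.
  by apply: prod_modP => -[|[|i]] //=; [exact: d_res_aug|exact: linear0].
- split=> // y _ [r [_ dy0]].
  have [s ys] := res_exact_aug (dy0 0%N).
  have bnd_y i : exists p, d i p = y i.+1 by apply: res_exact; exact: (dy0 i.+1).
  have [w wP] := prod_choice bnd_y; exists w => //; exists s; split=> [|i].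
    by rewrite prodB subr0 ys -linearZ /= -[in RHS](mulr1 s).
  by rewrite prodB /= wP subrr.
- exact: submodT.
- by [].
- by split=> // y _ _; exists 0 => //.
- have := @bij_filtration_prod _ _ d [set 0] xs (fun i => setT) nR.
  rewrite (_ : prod_set (fun i => setT) = setT); last by apply/seteqP; split.
  rewrite (_ : (fun i => setT `&` rad_torsion [set` xs]) = fun i => rad_torsion a).
    apply.
    + by split=> [//|_ _ -> ->|r _ ->] /=; rewrite ?addr0 ?mulr0.
    + by [].
    + by move=> i; apply: injective_baer; exact: res_injective.
    + by move=> i u _ r ->; exact: scale0r.
  by apply: functional_extensionality_dep => i; rewrite setTI axs rad_torsion_ideal_gen.
- by apply: submod_prod => i; exact: rad_torsionP.
- exact: d_stable_prod.
- split.
  + split=> [i||//]; [exact: (submod0 (rad_torsionP _ _))|exact: linear0].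
  + move=> u v [au du u0] [av dv v0]; split=> [i||i lt_hi].
    * exact: (submodD (rad_torsionP _ _) (au i) (av i)).
    * by rewrite prodD linearD du dv addr0.
    * by rewrite prodD u0 // v0 // addr0.
  + move=> r u [au du u0]; split=> [i||i lt_hi].
    * exact: (submodZ _ (rad_torsionP _ _) (au i)).
    * by rewrite prodZ linearZ_LR du scaler0.
    * by rewrite prodZ u0 // scaler0.
- exact: trunc_cap_quasi_iso.
- split=> [i|i||i _|]; try exact: (submod0 (rad_torsionP _ _)).
  + by rewrite addr0 linear0.
  + exact: addr0.
  + by split=> //; exact: linear0.
- exact: trunc_pairD.
- exact: trunc_pairZ.
- exact: trunc_pair_stable.
- exact: trunc_pair_surj.
- exact: trunc_pair_acyclic.
- move=> u v [Iu Jv _ uv [_ u0]]; split; apply: (@prod_torsion_bounded _ _ _ h.+1).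
  + by move=> i _ ->; apply: Iu.
  + exact: u0.
  + by move=> i _ ->; apply: Jv.
  + move=> i lt_hi; have := uv _ (ltnW lt_hi); by rewrite u0 // add0r.
Qed.

End Main.

(** A suitable power of an element of rad I outside rad J lies in I, and still not in rad J. *)
Lemma radical_not_sub (R : comNzRingType) (I J : set R) : is_ideal J ->
  ~ (radical I `<=` radical J) -> exists2 g, I g & ~ radical J g.
Proof.
move=> iJ IJ; apply: contrapT => nog; apply: IJ => x [k Ixk].
apply: contrapT => nJx; apply: nog; exists (x ^+ k) => // -[l].
by rewrite -exprM => Jxkl; apply: nJx; exists (k * l)%N.
Qed.

Theorem mainTheorem1 (R : comNzRingType) (m : set R)
    (R_noetherian : noetherian R) (R_local : local_ring m)
    (I J : set R) (I_proper : is_proper_ideal I) (J_proper : is_proper_ideal J)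
    (IJ : ~ (radical I `<=` radical J)) (JI : ~ (radical J `<=` radical I))
    (E : injective_resolution R^o) (h : nat)
    (depth_cap : has_depth (I `&` J) h)
    (cci_cap : forall i : nat, i <> h -> local_cohomology_zero E (I `&` J) i) :
  exists2 d : nat, has_depth (ideal_sum I J) d & (d <= h + 1)%N.
Proof.
have [iI _] := I_proper; have [iJ _] := J_proper.
have [[[im m1] _] _] := R_local.
have Im := proper_sub_maximal R_noetherian R_local I_proper.
have Jm := proper_sub_maximal R_noetherian R_local J_proper.
have ic := ideal_sumP iI iJ.
have pc : is_proper_ideal (ideal_sum I J).
  by split=> //; move/(ideal_sum_sub im Im Jm).
have [s smax] := exists_maximal_regular_seq_in R_noetherian (ideal_sum I J).
exists (size s); first exact: has_depth_of_maximal.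
(* Suppose that the depth is at least h + 2: then the (I + J)-torsion is exact up to degree h +
   1. *)
rewrite addn1 leqNgt; apply/negP => lt_hs.
have [sc reg _] := smax.
have [f Jf nIf] := radical_not_sub iI JI.
have [g Ig nJg] := radical_not_sub iJ IJ.
have ia : is_ideal (I `&` J) by exact: ideal_capP.
have [xs axs] := R_noetherian _ ia.
have cd_le i : (h < i)%N -> local_cohomology_zero E (I `&` J) i.
  by move=> lt_hi; apply: cci_cap => eq_ih; rewrite eq_ih ltnn in lt_hi.
have exIJ i : (i <= h.+1)%N ->
    exact_at (res_d E) (fun i => rad_torsion (ideal_sum I J)) i.
  by move=> le_ih; apply: (exact_below_regular R_noetherian ic reg sc); exact: leq_ltn_trans lt_hs.
have xsa : [set` xs] `<=` I `&` J by rewrite axs; exact: sub_ideal_gen.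
have [e [e' [n [ae [Ige Jge] [Ife Jfe]]]]] := split_data_elements ia xsa
  (split_data_resolution R_noetherian iI iJ cd_le exIJ Jf Ig axs).
have unit_cancel K x y : is_ideal K -> ~ m x -> K (y * x) -> K y.
  move=> iK /(local_unit R_noetherian R_local)[z zx] Kyx.
  by rewrite -(mulr1 y) -zx mulrCA; exact: ideal_mull.
(* Since 1 - e - e' is in m, one of e, e' is a unit. If e is, then g^n lies in J; if e' is, then f^n
   lies in I. *)
have [me|nme] := pselect (m e); last first.
  by apply: nJg; exists n; apply: unit_cancel nme Jge.
apply: nIf; exists n; apply: (unit_cancel _ e') => // me'; apply: m1.
rewrite -[1](subrK e) -[1 - e](subrK e'); apply: idealD => //.
by apply: idealD => //; apply: Im; case: ae.
Qed.
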